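(* Let $f\in\mathbb{K}[x_1,\ldots,x_n]$. In each of the following cases $f$ is partially Milnor non-degenerate: (1) the Newton diagram of $f$ is convenient and $f$ is Newton non-degenerate; (2) $f$ is Newton non-degenerate and $\mu(f)<\infty$; (3) $f$ is inner Newton non-degenerate.
   Context: $\mathbb{K}$ is an algebraically closed field of arbitrary characteristic, $n\ge1$, $[n]=\{1,\ldots,n\}$. For $f=\sum c_\alpha x^\alpha$, $\mathrm{Supp}(f)=\{\alpha:c_\alpha\ne0\}$; the Newton polytope is the convex hull of the support; the Newton diagram is the union of the compact faces of $(\mathbb{R}_{\ge0})^n+(\text{Newton polytope})$; a diagram is the Newton diagram of some polynomial. For $k=\mathbb{K}$ or $\mathbb{R}$ and $I\subseteq[n]$, $k^I=\{x\in k^n:x_i=0\text{ for }i\notin I\}$, $(\mathbb{K}^* )^I=\{x\in\mathbb{K}^I:x_i\ne0\text{ for }i\in I\}$, and $\Delta^I=\Delta\cap\mathbb{R}^I$ for $\Delta\subseteq\mathbb{R}^n$. $f|_{\mathbb{K}^I}\in\mathbb{K}[x_i:i\in I]$ is $f$ with $x_i=0$ for $i\notin I$. $\mathcal{V}_0^I$ is the set of weighted orders on $\mathbb{K}[x_i:i\in I]$ with positive integer weights $(\nu_i)_{i\in I}$ of gcd $1$, $\nu(\sum c_\alpha x^\alpha)=\min\{\nu\cdot\alpha:c_\alpha\ne0\}$; $\mathcal{V}_0=\mathcal{V}_0^{[n]}$; $\mathrm{In}_\nu(g)$ is the sum of the terms of $g$ with minimal $\nu$-value, $\mathrm{In}_\nu(0)=0$;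 $\nu(\Gamma)=\inf\{\nu\cdot\alpha:\alpha\in\Gamma\}$. $\mathfrak{j}(f)$ is the ideal generated by the partial derivatives of $f$; the Milnor number is $\mu(f)=\dim_{\mathbb{K}}\mathbb{K}[[x_1,\ldots,x_n]]/\mathfrak{j}(f)\mathbb{K}[[x_1,\ldots,x_n]]$. A $C$-polytope is a diagram containing a point with positive coordinate on every coordinate axis. The Newton diagram of $f$ is convenient if it is a $C$-polytope. $f$ is Newton non-degenerate if $\mathfrak{j}(\mathrm{In}_\nu(f))$ has no zero in $(\mathbb{K}^* )^n$ for each $\nu\in\mathcal{V}_0$. A point $\alpha\in(\mathbb{R}_{\ge0})^n$ lies below a diagram $\mathcal{P}$ if there is $\nu\in\mathcal{V}_0$ with $\nu\cdot\alpha<\nu(\mathcal{P})$. An inner face of $\mathcal{P}$ is a face not contained in any coordinate subspace. If no point of $\mathrm{Supp}(f)$ lies below $\mathcal{P}$ and $\Delta$ is a face of $\mathcal{P}$, then $\mathrm{In}_\Delta(f)=\sum_{\alpha\in\Delta}c_\alpha x^\alpha$. $f$ is inner Newton non-degenerate with respect to a $C$-polytope $\mathcal{P}$ if no point of $\mathrm{Supp}(f)$ lies below $\mathcal{P}$ and, for every inner face $\Delta$ of $\mathcal{P}$ and every non-empty $I\subseteq[n]$, $\Delta^I\ne\emptyset$ implies $V(\mathfrak{j}(\mathrm{In}_\Delta(f)))\cap(\mathbb{K}^* )^I=\emptyset$. $f$ is inner Newton non-degenerate if it is so with respect to some $C$-polytope. Let $\Gamma_j$ be the Newton diagram of $\partial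 f/\partial x_j$. $[\Gamma_1,\ldots,\Gamma_n]_0$ is the minimum of $\dim_{\mathbb{K}}\mathbb{K}[[x_1,\ldots,x_n]]/\langle g_1,\ldots,g_n\rangle$ over polynomials $g_j$ with Newton diagrams $\Gamma_j$. $f$ is partially Milnor non-degenerate if $[\Gamma_1,\ldots,\Gamma_n]_0<\infty$ and for every non-empty $I\subseteq[n]$ and every $\nu\in\mathcal{V}_0^I$, the polynomials $\mathrm{In}_\nu((\partial f/\partial x_1)|_{\mathbb{K}^I}),\ldots,\mathrm{In}_\nu((\partial f/\partial x_n)|_{\mathbb{K}^I})$ have no common zero in $(\mathbb{K}^* )^n$. *)

(* Defs.v *)
From HB Require Import structures.
From mathcomp Require Import all_boot all_order all_algebra.
(* mpoly must be imported before the analysis files: the opposite order fails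
   on incompatible notation levels. *)
From mathcomp Require Import mpoly.
From mathcomp Require Import boolp classical_sets functions reals ereal.
From mathcomp Require Import topology normedtype convex.

Set Implicit Arguments.
Unset Strict Implicit.
Unset Printing Implicit Defensive.

Import Order.TTheory GRing.Theory Num.Theory.
Import numFieldNormedType.Exports.

Local Open Scope ring_scope.
Local Open Scope classical_set_scope.

(* K[[x_1, ..., x_n]]: a series is its family of coefficients. This is a
   separate constant so that the product is the Cauchy product and not the
   pointwise product that functions.v puts on 'X_{1..n} -> K. *)
Definition mseries (n : nat) (K : comNzRingType) : Type := 'X_{1..n} -> K.

Section SeriesRing.
Variables (n : nat) (K : comNzRingType).
Implicit Types (a b c : mseries n K) (m : 'X_{1..n}).

HB.instance Definition _ := GRing.Lmodule.copy (mseries n K) ('X_{1..n} -> K^o).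

Lemma mserD a b m : (a + b) m = a m + b m.
Proof. by []. Qed.

Lemma mserZ (u : K) a m : (u *: a) m = u * a m.
Proof. by []. Qed.

Definition mser_one : mseries n K := fun m => (m == 0%MM)%:R.

Definition mser_mul a b : mseries n K := fun m =>
  \sum_(k : 'X_{1..n < (mdeg m).+1, (mdeg m).+1} | m == (k.1 + k.2)%MM)
    a k.1 * b k.2.

Definition mser_trunc d a : {mpoly K[n]} :=
  \sum_(m : 'X_{1..n < d}) a m *: 'X_[m].

Let mcoeffM_eq d (p p' q q' : {mpoly K[n]}) :
    (forall m, mdeg m < d -> p@_m = p'@_m)%N ->
    (forall m, mdeg m < d -> q@_m = q'@_m)%N ->
  forall m, (mdeg m < d)%N -> (p * q)@_m = (p' * q')@_m.
Proof.
move=> pp' qq' m md; rewrite !mcoeffM; apply: eq_bigr => k _.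
by rewrite pp' ?qq' // (leq_trans (bmdeg _)).
Qed.

Let truncE d a m : (mdeg m < d)%N -> (mser_trunc d a)@_m = a m.
Proof. exact: mcoeff_mpoly. Qed.

Let mser_mulE d a b m : (mdeg m < d)%N ->
  mser_mul a b m = (mser_trunc d a * mser_trunc d b)@_m.
Proof.
move=> md; rewrite mcoeffM; apply: eq_bigr => k _.
by rewrite !truncE // (leq_trans (bmdeg _)).
Qed.

Let mser_mulA : associative mser_mul.
Proof.
move=> a b c; apply/funext => m; have md := ltnSn (mdeg m).
rewrite !(mser_mulE _ _ md).
rewrite [LHS](mcoeffM_eq (p' := mser_trunc (mdeg m).+1 a)
  (q' := mser_trunc (mdeg m).+1 b * mser_trunc (mdeg m).+1 c) _ _ md) //.
  rewrite mulrA; apply: (mcoeffM_eq _ _ md) => // k kd.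
  by rewrite truncE // (mser_mulE _ _ kd).
by move=> k kd; rewrite truncE // (mser_mulE _ _ kd).
Qed.

Let mser_mulC : commutative mser_mul.
Proof.
move=> a b; apply/funext => m; have md := ltnSn (mdeg m).
by rewrite !(mser_mulE _ _ md) mulrC.
Qed.

Let mser_mul1 : left_id mser_one mser_mul.
Proof.
move=> a; apply/funext => m; have md := ltnSn (mdeg m).
rewrite (mser_mulE _ _ md).
rewrite (mcoeffM_eq (p' := 1) (q' := mser_trunc (mdeg m).+1 a) _ _ md) //.
  by rewrite mul1r truncE.
by move=> k kd; rewrite truncE // mcoeff1.
Qed.

Let mser_mulDl : left_distributive mser_mul +%R.
Proof.
move=> a b c; apply/funext => m.
rewrite mserD /mser_mul -big_split /=; apply: eq_bigr => k _.
by rewrite mserD mulrDl.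
Qed.

Let mser_one_neq0 : mser_one != 0.
Proof.
apply/eqP => /(congr1 (fun a : mseries n K => a 0%MM)).
by rewrite /mser_one eqxx => /eqP; rewrite oner_eq0.
Qed.

HB.instance Definition _ := GRing.Zmodule_isComNzRing.Build (mseries n K)
  mser_mulA mser_mulC mser_mul1 mser_mulDl mser_one_neq0.

Definition mser_of_mpoly (p : {mpoly K[n]}) : mseries n K := fun m => p@_m.

End SeriesRing.

Definition gen_ideal (A : comNzRingType) (n : nat) (g : 'I_n -> A) : set A :=
  [set h | exists a : 'I_n -> A, h = \sum_i a i * g i].

(* The family e is a basis of the quotient of V by the subspace J. *)
Definition quotient_basis (K : fieldType) (V : lmodType K) (J : set V)
    (d : nat) (e : 'I_d -> V) : Prop :=
  (forall v, exists c : 'I_d -> K, J (v - \sum_i c i *: e i)) /\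
  (forall c : 'I_d -> K, J (\sum_i c i *: e i) -> forall i, c i = 0).

(* dim_K (V / J) in the extended reals; it is +oo, the infimum of the empty
   set, when V / J has no finite basis. *)
Definition quotient_dim (R : realType) (K : fieldType) (V : lmodType K)
    (J : set V) : \bar R :=
  ereal_inf [set d%:R%:E | d in
    [set d | exists e : 'I_d -> V, quotient_basis J e]].

(* dim_K K[[x_1, ..., x_n]] / <g_1, ..., g_n> *)
Definition local_dim (R : realType) (K : fieldType) (n : nat)
    (g : 'I_n -> {mpoly K[n]}) : \bar R :=
  quotient_dim R (gen_ideal (fun j => mser_of_mpoly (g j))).

Definition milnor_number (R : realType) (K : fieldType) (n : nat)
    (f : {mpoly K[n]}) : \bar R :=
  local_dim R (fun j => f^`M(j)).

Section Geometry.
Variables (R : realType) (n : nat).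
Implicit Types (P F : set 'rV[R]_n) (x y : 'rV[R]_n).

Definition dotr x y : R := \sum_i x 0 i * y 0 i.

Definition orthant : set 'rV[R]_n := [set x | forall i, 0 <= x 0 i].

(* The subspace R^I *)
Definition coord_subspace (I : {set 'I_n}) : set 'rV[R]_n :=
  [set x | forall i, i \notin I -> x 0 i = 0].

(* Faces of a convex polyhedron: the subsets cut out by a linear inequality
   valid on P. The set P itself and the empty set are allowed. *)
Definition face P F : Prop :=
  exists (l : 'rV[R]_n) (c : R),
    (forall x, P x -> c <= dotr l x) /\ F = P `&` [set x | dotr l x = c].

Definition mpoint (m : 'X_{1..n}) : 'rV[R]_n := \row_i (m i)%:R.

Definition newton_polytope (K : fieldType) (f : {mpoly K[n]}) : set 'rV[R]_n :=
  smallest (@convex_set R 'rV[R]_n) [set mpoint m | m in [set` msupp f]].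

Definition newton_polyhedron (K : fieldType) (f : {mpoly K[n]}) :
    set 'rV[R]_n :=
  [set x + y | x in orthant & y in newton_polytope f].

Definition newton_diagram (K : fieldType) (f : {mpoly K[n]}) : set 'rV[R]_n :=
  \bigcup_(F in [set F | face (newton_polyhedron f) F /\ compact F]) F.

(* V_0^I, a weight vector on I being extended by 0 outside I; V_0 is the case
   I = [n]. *)
Definition weights (I : {set 'I_n}) : set ('I_n -> nat) :=
  [set nu | (forall i, (0 < nu i)%N = (i \in I)) /\
            \big[gcdn/0%N]_(i in I) nu i = 1%N].

Definition wdot (nu : 'I_n -> nat) x : R := \sum_i (nu i)%:R * x 0 i.

Definition wmin (nu : 'I_n -> nat) P : \bar R :=
  ereal_inf [set (wdot nu x)%:E | x in P].

Definition lies_below P x : Prop :=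
  exists nu, weights [set: 'I_n] nu /\ ((wdot nu x)%:E < wmin nu P)%E.

End Geometry.

Arguments newton_polytope R {n K} f.
Arguments newton_polyhedron R {n K} f.
Arguments newton_diagram R {n K} f.

Section Diagrams.
Variables (R : realType) (K : fieldType) (n : nat).
Implicit Types (P D : set 'rV[R]_n).

Definition is_diagram P : Prop :=
  exists g : {mpoly K[n]}, P = newton_diagram R g.

Definition C_polytope P : Prop :=
  is_diagram P /\
  forall i, exists x, [/\ P x, coord_subspace [set i]%SET x & 0 < x 0 i].

(* The faces of a diagram are the compact faces of the Newton polyhedron whose
   union it is. *)
Definition diagram_face P D : Prop :=
  exists g : {mpoly K[n]},
    [/\ P = newton_diagram R g, face (newton_polyhedron R g) D & compact D].

Definition inner_face P D : Prop :=
  diagram_face P D /\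
  forall I : {set 'I_n}, I != [set: 'I_n]%SET -> ~ D `<=` @coord_subspace R n I.

End Diagrams.

Section NonDegeneracy.
Variables (R : realType) (K : fieldType) (n : nat).
Implicit Types (f g : {mpoly K[n]}) (I : {set 'I_n}).

Definition jacobian_ideal f : set {mpoly K[n]} :=
  gen_ideal (fun j => f^`M(j)).

Definition zero_locus (J : set {mpoly K[n]}) : set ('I_n -> K) :=
  [set x | forall h, J h -> h.@[x] = 0].

(* (K^* )^I *)
Definition torus I : set ('I_n -> K) :=
  [set x | forall i, (x i != 0) = (i \in I)].

Definition wdeg (nu : 'I_n -> nat) (m : 'X_{1..n}) : nat :=
  (\sum_i nu i * m i)%N.

Definition weight_initial (nu : 'I_n -> nat) g : {mpoly K[n]} :=
  \sum_(m <- msupp g | all (fun m' => wdeg nu m <= wdeg nu m')%N (msupp g))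
    g@_m *: 'X_[m].

Definition face_initial (D : set 'rV[R]_n) f : {mpoly K[n]} :=
  \sum_(m <- msupp f | `[< D (mpoint R m) >]) f@_m *: 'X_[m].

(* The restriction of g to K^I, viewed inside K[x_1, ..., x_n] *)
Definition restrict_coord I g : {mpoly K[n]} :=
  g \mPo [tuple (if i \in I then 'X_i else 0) | i < n].

Definition convenient f : Prop := C_polytope K (newton_diagram R f).

Definition newton_nondegenerate f : Prop :=
  forall nu, weights [set: 'I_n] nu ->
    zero_locus (jacobian_ideal (weight_initial nu f)) `&`
      torus [set: 'I_n] = set0.

Definition inner_nondegenerate_wrt f (P : set 'rV[R]_n) : Prop :=
  (forall m, m \in msupp f -> ~ lies_below P (mpoint R m)) /\
  (forall D, inner_face K P D ->
   forall I, I != finset.set0 -> D `&` coord_subspace I !=set0 ->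
     zero_locus (jacobian_ideal (face_initial D f)) `&` torus I = set0).

Definition inner_newton_nondegenerate f : Prop :=
  exists2 P, C_polytope K P & inner_nondegenerate_wrt f P.

(* [Gamma_1, ..., Gamma_n]_0; the minimum is an infimum of elements of
   {0, 1, 2, ...} with +oo added. *)
Definition mixed_multiplicity (Gamma : 'I_n -> set 'rV[R]_n) : \bar R :=
  ereal_inf [set local_dim R g | g in
    [set g : 'I_n -> {mpoly K[n]} |
      forall j, newton_diagram R (g j) = Gamma j]].

Definition partially_milnor_nondegenerate f : Prop :=
  (mixed_multiplicity (fun j => newton_diagram R f^`M(j)) < +oo)%E /\
  (forall I, I != finset.set0 -> forall nu, weights I nu ->
     ~ exists2 x, torus [set: 'I_n] x &
         forall j, (weight_initial nu (restrict_coord I f^`M(j))).@[x] = 0).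

End NonDegeneracy.

(* Main.v *)
Require Import Defs.
From mathcomp Require Import all_boot all_order all_algebra.
From mathcomp Require Import mpoly.
From mathcomp Require Import reals ereal.
From HB Require Import structures.
From mathcomp Require Import fraction zify ring lra.
From mathcomp Require Import boolp classical_sets topology normedtype convex.

(** Why the theorem holds.  Partial Milnor non-degeneracy has two clauses: finiteness
    of [Gamma_1, ..., Gamma_n]_0, and the torus condition, that for every non-empty I
    and every nu in V_0^I the initial forms of the restrictions to K^I of the partial
    derivatives of f have no common zero in the torus.

    The torus condition implies the finiteness clause (lemma [local_dim_finite]): it
    makes the Milnor number of f finite, and the derivatives of f are one of the systems
    over which the minimum is taken.  To see this, suppose that the local algebra of the
    derivatives is infinite dimensional.  Then for some I no product of a monomial in
    the variables of I with a unit lies in the ideal of the restrictions to K^I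
    ([nilpotent_vars]), so evaluation at the origin of K^I is well defined modulo the
    Laurent ideal of the system.  By Chevalley's argument ([place_extend]) it extends to
    a homomorphism to K that is defined on enough Laurent monomials to compare any two
    monomials of the system; only one element is adjoined at a time, so only
    one-variable algebra over the algebraically closed field K is needed.  Monomials of
    value zero give the weight, by linear duality over the rationals ([motzkin]), and
    those of nonzero value give the torus point, by extension of characters
    ([character_extension]).  This is [tropical_zero]: the torus condition fails.

    It remains to prove the torus condition in each case.  Let x be a common zero of the
    initial forms for I and nu.

    If f is Newton non-degenerate and does not vanish on K^I, which is the case for a
    convenient f, give the variables off I large weights: the initial form of f is that
    of the restriction of f, and x is a zero of its Jacobian ideal
    ([nondegenerate_restrict]).

    If f vanishes on K^I, then f = sum of x_j h_j over j outside I, up to terms of higher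
    order in these x_j.  When the Milnor number is finite at least #|I| of the h_j are
    nonzero ([finite_system_count], by counting dimensions); then the gradients of their
    initial forms at x are dependent, and a linear relation between them gives the
    missing coordinates of a torus point at which an initial form of f is singular
    ([nondegenerate_vanishing]).

    If f is inner non-degenerate for a C-polytope P, lower the weights nu, extended by
    large weights off I, one coordinate at a time until the face of P of minimal weight
    is inner ([cover_all]).  The coordinates in I whose weight has not changed form a set
    I' that meets the face, and the point that agrees with x on I' and is 0 elsewhere
    violates the condition for this face and I' ([inner_nondegenerate_restrict]). *)

Set Implicit Arguments.
Unset Strict Implicit.
Unset Printing Implicit Defensive.

Import Order.TTheory GRing.Theory Num.Theory.
Import numFieldNormedType.Exports.

Local Open Scope ring_scope.

(** * Homomorphisms on subrings, with an ideal to kill *)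

(** A nonzero element of least degree divides all the others, and it has a root
unless it is a constant. *)
Lemma ideal_common_root (K : closedFieldType) (A : {poly K} -> Prop) :
  (forall p q r, A p -> A q -> A (p + q * r)) ->
  (exists c, forall q, A q -> q.[c] = 0) \/ A 1.
Proof.
move=> Acl; have [[q0 [Aq0 nz0]]|none] := pselect (exists q, A q /\ q != 0); last first.
  left; exists 0 => q Aq; have [->|nz] := eqVneq q 0; first by rewrite horner0.
  by case: none; exists q.
have exP : exists m, `[< exists q, [/\ A q, q != 0 & size q = m] >].
  by exists (size q0); apply/asboolP; exists q0.
have [m /asboolP[q [Aq nzq sq]] mmin] := ex_minnP exP.
have A_dvd r : A r -> q %| r.
  move=> Ar; apply/modp_eq0P/eqP; case: (eqVneq (r %% q) 0) => // nz.
  have := ltn_modpN0 r nzq; rewrite sq ltnNge mmin //; apply/asboolP.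
  exists (r %% q); split=> //.
  have -> : r %% q = r + q * - (r %/ q).
    by rewrite mulrN mulrC {2}(divp_eq r q) addrC addKr.
  exact: Acl.
have [sq1|sq1] := eqVneq (size q) 1.
  right; have /size_poly1P[c nzc qE] : size q == 1 by rewrite sq1.
  have -> : 1 = q + q * ((c^-1)%:P - 1).
    by rewrite mulrBr mulr1 addrCA subrr addr0 qE -polyCM mulfV.
  exact: Acl.
have [c /rootP rc] := closed_rootP q sq1; left; exists c => r /A_dvd /dvdpP[s ->].
by rewrite hornerM rc mulr0.
Qed.

(** The graph G of a ring homomorphism from a subring of E contained in R onto K,
which kills every element of J in its domain; [place_kill] also makes G single valued
when 0 is in J.  With the graph, extending the homomorphism to an element t means
adding one pair (t, c) to a subring of E * K. *)
Record partial_place (E : comNzRingType) (K : fieldType) (R J : E -> Prop)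
    (G : E -> K -> Prop) : Prop := PartialPlace {
  place_dom : forall x a, G x a -> R x;
  place_kill : forall x a, G x a -> J x -> a = 0;
  place1 : G 1 1;
  placeB : forall x y a b, G x a -> G y b -> G (x - y) (a - b);
  placeM : forall x y a b, G x a -> G y b -> G (x * y) (a * b);
  place_surj : forall a, exists x, G x a }.

Section PlaceTheory.
Variables (E : comNzRingType) (K : fieldType) (R J : E -> Prop) (G : E -> K -> Prop).
Hypothesis pG : partial_place R J G.

Lemma place0 : G 0 0.
Proof. by have := placeB pG (place1 pG) (place1 pG); rewrite !subrr. Qed.

Lemma placeD x y a b : G x a -> G y b -> G (x + y) (a + b).
Proof.
move=> Gx Gy; have := placeB pG Gx (placeB pG place0 Gy).
by rewrite !sub0r !opprK.
Qed.

Lemma place_sum I (r : seq I) (P : pred I) (F : I -> E) (H : I -> K) :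
  (forall i, P i -> G (F i) (H i)) ->
  G (\sum_(i <- r | P i) F i) (\sum_(i <- r | P i) H i).
Proof.
move=> GF; elim/big_rec2: _ => [|i x y Pi Gxy]; first exact: place0.
by apply: placeD => //; apply: GF.
Qed.

Definition coef_place (p : {poly E}) (q : {poly K}) := forall k, G p`_k q`_k.

Lemma coef_placeM p q p' q' :
  coef_place p q -> coef_place p' q' -> coef_place (p * p') (q * q').
Proof.
move=> Gp Gp' k; rewrite !coefM; apply: place_sum => i _.
by apply: (placeM pG).
Qed.

Lemma coef_placeB p q p' q' :
  coef_place p q -> coef_place p' q' -> coef_place (p - p') (q - q').
Proof. by move=> Gp Gp' k; rewrite !coefB; apply: (placeB pG). Qed.

Lemma coef_placeD p q p' q' :
  coef_place p q -> coef_place p' q' -> coef_place (p + p') (q + q').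
Proof. by move=> Gp Gp' k; rewrite !coefD; apply: placeD. Qed.

Lemma coef_placeC x a : G x a -> coef_place x%:P a%:P.
Proof. by move=> Gx k; rewrite !coefC; case: eqP => // _; apply: place0. Qed.

Lemma coef_placeX : coef_place 'X 'X.
Proof. by move=> k; rewrite !coefX; case: eqP => // _; [apply: place1 pG|apply: place0]. Qed.

Lemma coef_place_lift (q : {poly K}) : exists p, coef_place p q.
Proof.
elim/poly_ind: q => [|q c [p Gp]].
  by exists 0 => k; rewrite !coef0; apply: place0.
have [x Gx] := place_surj pG c; exists (p * 'X + x%:P).
by apply: coef_placeD (coef_placeC Gx); apply: coef_placeM coef_placeX.
Qed.

Lemma place_horner_dom p q t :
  (forall x y, R x -> R y -> R (x + y)) -> (forall x y, R x -> R y -> R (x * y)) ->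
  R t -> coef_place p q -> R p.[t].
Proof.
move=> RD RM Rt Gp; rewrite horner_coef; elim/big_ind: _ => //.
  exact: (place_dom pG place0).
move=> i _; apply: (RM); first exact: (place_dom pG (Gp i)).
elim: (i : nat) => [|k IHk]; first by rewrite expr0; apply: (place_dom pG (place1 pG)).
by rewrite exprS; apply: (RM).
Qed.

End PlaceTheory.

Section PlaceExtension.
Variables (E : comNzRingType) (K : closedFieldType) (R J : E -> Prop).
Hypotheses (RD : forall x y, R x -> R y -> R (x + y))
  (RM : forall x y, R x -> R y -> R (x * y))
  (RJ : forall x y, R x -> J y -> J (x * y))
  (JD : forall x y, J x -> J y -> J (x + y)).

Section Step.
Variable G : E -> K -> Prop.
Hypothesis pG : partial_place R J G.

(** Chevalley's argument.  Here p and p' reduce to the constant 1 and s is the inverse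
of t.  Cancelling the leading term of the longer relation with a multiple of the
shorter one, scaled so that the constant term still reduces to 1, shortens the
pair; in the end a constant that reduces to 1 lies in J, which is impossible. *)
Lemma place_no_mutual_inversion t s n m (p p' : {poly E}) :
  t * s = 1 -> R t -> R s ->
  (size p <= n.+1)%N -> (size p' <= m.+1)%N ->
  coef_place G p 1 -> coef_place G p' 1 -> J p.[t] -> J p'.[s] -> False.
Proof.
move: {2}(n + m)%N (leqnn (n + m)) => N.
elim: N t s n m p p' => [|N IHN] t s n m p p' nmN ts Rt Rs sp sp' Gp Gp' Jp Jp'.
  move: nmN sp; rewrite leqn0 addn_eq0 => /andP[/eqP-> _] /size1_polyC pE.
  move: Jp (Gp 0%N); rewrite pE hornerC coefC coef1 /= => Jp Gp0.
  by have /eqP := place_kill pG Gp0 Jp; rewrite oner_eq0.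
wlog le_mn : t s n m p p' nmN ts Rt Rs sp sp' Gp Gp' Jp Jp' / (m <= n)%N => [hw|].
  have [le|/ltnW le] := leqP m n; first by apply: (hw t s n m p p').
  by apply: (hw s t m n p' p) => //; rewrite 1?addnC 1?mulrC.
case: n nmN sp le_mn => [|n] nmN sp le_mn.
  move: sp => /size1_polyC pE.
  move: Jp (Gp 0%N); rewrite pE hornerC coefC coef1 /= => Jp Gp0.
  by have /eqP := place_kill pG Gp0 Jp; rewrite oner_eq0.
(* the relation at s, multiplied by a power of t *)
pose rv := \poly_(i < m.+1) p'`_(m - i).
have rvE : rv.[t] = t ^+ m * p'.[s].
  rewrite horner_poly (horner_coef_wide _ sp') mulr_sumr.
  rewrite (reindex_inj rev_ord_inj) /=; apply: eq_bigr => i _.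
  rewrite subSS subKn; last by rewrite -ltnS.
  rewrite mulrCA; congr (_ * _).
  have /subnK {3}<- : (i <= m)%N by rewrite -ltnS.
  by rewrite exprD -mulrA -exprMn ts expr1n mulr1.
pose P := p * (p'`_0)%:P - rv * 'X^(n.+1 - m) * (p`_n.+1)%:P.
have coefP k : P`_k = p`_k * p'`_0 -
    (if (k < n.+1 - m)%N then 0 else rv`_(k - (n.+1 - m))) * p`_n.+1.
  by rewrite coefB !coefMC coefMXn.
have Grv k : exists b, G rv`_k b.
  rewrite coef_poly; case: ifP => _; first by eexists; apply: Gp'.
  by exists 0; apply: place0 pG.
apply: (IHN t s n m P p') => //.
- apply/leq_sizeP => k le_nk; rewrite coefP ifF; last by lia.
  have [->|ne] := eqVneq k n.+1.
    by rewrite coef_poly subKn // ltnSn subnn mulrC subrr.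
  rewrite (leq_sizeP _ _ sp) ?mul0r; last by lia.
  by rewrite coef_poly ifF ?mul0r ?subr0 //; lia.
- move=> k; rewrite coefP.
  have Gpn := Gp n.+1; rewrite coef1 /= in Gpn.
  have [b Gb] : exists b, G (if (k < n.+1 - m)%N then 0 else rv`_(k - (n.+1 - m))) b.
    by case: ifP => _; [exists 0; apply: place0 pG | apply: Grv].
  have -> : (1 : {poly K})`_k = (1 : {poly K})`_k * 1 - b * 0 by rewrite mulr1 mulr0 subr0.
  apply: (placeB pG); last exact: (placeM pG).
  by apply: (placeM pG); [apply: Gp | have := Gp' 0%N; rewrite coef1].
have -> : P.[t] = p'`_0 * p.[t] + (- p`_n.+1 * t ^+ n.+1) * p'.[s].
  have -> : t ^+ n.+1 = t ^+ (n.+1 - m) * t ^+ m by rewrite -exprD subnK.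
  rewrite hornerD hornerN !hornerM hornerXn !hornerC rvE; ring.
have R0 : R 0 by apply: (place_dom pG (place0 pG)).
have RN x : (exists a, G x a) -> R (- x).
  case=> a Gx; apply: (place_dom pG (a := 0 - a)).
  by rewrite -sub0r; apply: (placeB pG) Gx; apply: place0 pG.
apply: JD; apply: RJ => //; first exact: (place_dom pG (Gp' 0%N)).
apply: RM; first by apply: RN; eexists; apply: Gp.
elim: (n.+1) => [|k IHk]; first by rewrite expr0; apply: (place_dom pG (place1 pG)).
by rewrite exprS; apply: RM.
Qed.

(** The reductions of the polynomials p with p.[t] in J form an ideal of K[T], and the
possible values at t are exactly its common roots. *)
Lemma place_adjoin t : R t ->
  (exists G' : E -> K -> Prop, [/\ partial_place R J G',
     forall x a, G x a -> G' x a & exists c, G' t c]) \/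
  (exists p : {poly E}, coef_place G p 1 /\ J p.[t]).
Proof.
move=> Rt; pose A q := exists p : {poly E}, coef_place G p q /\ J p.[t].
have [] := @ideal_common_root K A.
- move=> p q r [p1 [Gp Jp]] [q1 [Gq Jq]].
  have [r1 Gr] := coef_place_lift pG r; exists (p1 + q1 * r1); split.
    by apply: (coef_placeD pG) => //; apply: (coef_placeM pG).
  rewrite hornerD hornerM; apply: JD => //; rewrite mulrC; apply: RJ => //.
  exact: (place_horner_dom pG RD RM Rt Gr).
- case=> c Ac; left.
  exists (fun x a => exists p q, [/\ coef_place G p q, x = p.[t] & a = q.[c]]).
  split; last 1 first.
  + by exists c; exists 'X, 'X; split; [apply: coef_placeX pG| |]; rewrite hornerX.
  + split.
    * by move=> _ _ [p [q [Gp -> _]]]; apply: (place_horner_dom pG RD RM Rt Gp).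
    * by move=> _ _ [p [q [Gp -> ->]]] Jp; apply: Ac; exists p.
    * exists 1%:P, 1%:P; split; rewrite ?hornerC //.
      by apply: (coef_placeC pG) => //; apply: place1 pG.
    * move=> _ _ _ _ [p [q [Gp -> ->]]] [p' [q' [Gp' -> ->]]].
      by exists (p - p'), (q - q'); split; rewrite ?hornerD ?hornerN //; apply: (coef_placeB pG).
    * move=> _ _ _ _ [p [q [Gp -> ->]]] [p' [q' [Gp' -> ->]]].
      by exists (p * p'), (q * q'); split; rewrite ?hornerM //; apply: (coef_placeM pG).
    * move=> a; have [x Gx] := place_surj pG a; exists x, x%:P, a%:P.
      by split; rewrite ?hornerC //; apply: (coef_placeC pG).
  + move=> x a Gx; exists x%:P, a%:P.
    by split; rewrite ?hornerC //; apply: (coef_placeC pG).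
- by case=> p Ap; right; exists p.
Qed.

(** By [place_no_mutual_inversion] the obstruction of [place_adjoin] cannot occur for
both t and its inverse. *)
Lemma place_extend t s : t * s = 1 -> R t -> R s ->
  exists G' : E -> K -> Prop, [/\ partial_place R J G',
     forall x a, G x a -> G' x a & exists c, G' t c \/ G' s c].
Proof.
move=> ts Rt Rs; have [[G' [pG' sG [c Gc]]]|[p [Gp Jp]]] := place_adjoin Rt.
  by exists G'; split=> //; exists c; left.
have [[G' [pG' sG [c Gc]]]|[q [Gq Jq]]] := place_adjoin Rs.
  by exists G'; split=> //; exists c; right.
by have := place_no_mutual_inversion ts Rt Rs (leqSpred _) (leqSpred _) Gp Gq Jp Jq.
Qed.

End Step.

Lemma place_extend_seq (T : eqType) (ts ss : T -> E) (r : seq T) (G : E -> K -> Prop) :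
  partial_place R J G ->
  (forall i, [/\ ts i * ss i = 1, R (ts i) & R (ss i)]) ->
  exists G' : E -> K -> Prop, [/\ partial_place R J G',
     forall x a, G x a -> G' x a &
     forall i, i \in r -> exists c, G' (ts i) c \/ G' (ss i) c].
Proof.
move=> pG tsP; elim: r => [|i r [G1 [pG1 sG1 IH]]]; first by exists G; split.
have [tsi Rt Rs] := tsP i.
have [G2 [pG2 sG2 [c Gc]]] := place_extend pG1 tsi Rt Rs.
exists G2; split=> // [x a Gx|j]; first by apply/sG2/sG1.
rewrite inE => /predU1P[->|/IH [b Gb]]; first by exists c.
by exists b; case: Gb => /sG2; [left|right].
Qed.

End PlaceExtension.

(** * Motzkin's transposition theorem *)

Lemma mulmxDZE n (x : 'rV[rat]_n) (y z : 'cV_n) (c : rat) :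
  (x *m (y + c *: z)) 0 0 = (x *m y) 0 0 + c * (x *m z) 0 0.
Proof. by rewrite mulmxDr -scalemxAr mxE [X in _ + X]mxE. Qed.

(** C stands for the cone of positive combinations of us: quantifying over it avoids
all bookkeeping of coefficients.  In the induction step w is positive on us but
not on u.  Either some w1 is positive on us and zero on u, and a small
perturbation of w1 works; or a point z of the cone is v + b u with v in the
span of V; the signs of w at z and at u force b < 0, so that v = z - b u is in the
cone. *)
Lemma motzkin (n : nat) (us : seq 'rV[rat]_n) (C : 'rV[rat]_n -> Prop) q (V : 'M[rat]_(q, n)) :
  (forall x y, C x -> C y -> C (x + y)) ->
  (forall (a : rat) x, 0 < a -> C x -> C (a *: x)) ->
  (forall u, u \in us -> C u) ->
  (exists w : 'cV[rat]_n, V *m w = 0 /\ forall u, u \in us -> 0 < (u *m w) 0 0) \/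
  (exists z, C z /\ (z <= V)%MS).
Proof.
elim: us C q V => [|u us IHus] C q V CD CZ Cus.
  by left; exists 0; rewrite mulmx0.
have Cu : C u by apply: Cus; rewrite mem_head.
have Cus' v : v \in us -> C v by move=> vus; apply: Cus; rewrite inE vus orbT.
have [[w [Vw usw]]|] := IHus C q V CD CZ Cus'; last by right.
have [uw|uw] := ltP 0 ((u *m w) 0 0).
  left; exists w; split=> // v; rewrite inE => /predU1P[->|/usw] //.
have [uV|nuV] := boolP (u <= V)%MS; first by right; exists u.
have [w0 [Vw0 uw0]] : exists w0 : 'cV[rat]_n, V *m w0 = 0 /\ 0 < (u *m w0) 0 0.
  move: nuV; rewrite submxE => /rV0Pn[j].
  have -> : (u *m cokermx V) 0 j = (u *m col j (cokermx V)) 0 0.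
    by rewrite colE [in RHS]mulmxA -colE [RHS]mxE.
  set c := col _ _ => nz.
  have Vc : V *m c = 0 by rewrite /c colE mulmxA mulmx_coker mul0mx.
  have [pos|neg|/eqP] := ltgtP 0 ((u *m c) 0 0); first by exists c.
    by exists (- c); rewrite mulmxN Vc oppr0 mulmxN mxE oppr_gt0.
  by rewrite eq_sym (negbTE nz).
(* the sub-cone where w is positive still contains us, and it forces 0 < z w below *)
have [||v vus|[w1 [Vuw1 usw1]]|[z [[Cz zw] zV]]] :=
  IHus (fun z => C z /\ 0 < (z *m w) 0 0) _ (col_mx V u).
- by move=> x y [Cx xw] [Cy yw]; split; [apply: CD | rewrite mulmxDl mxE addr_gt0].
- by move=> a x a0 [Cx xw]; split; [apply: CZ | rewrite -scalemxAl mxE mulr_gt0].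
- by split; [apply: Cus' | apply: usw].
(* a small multiple of w0 makes u positive and keeps us positive *)
- move: Vuw1; rewrite mul_col_mx => /eqP; rewrite col_mx_eq0 => /andP[/eqP Vw1 /eqP uw1].
  left; have [e [e0 He]] : exists e : rat, 0 < e /\
      forall v, v \in us -> 0 < (v *m (w1 + e *: w0)) 0 0.
    elim: us usw1 {IHus Cus Cus' usw} => [_|v us IHus' usw1]; first by exists 1.
    have [|e [e0 He]] := IHus'; first by move=> v' v'us; apply: usw1; rewrite inE v'us orbT.
    have vw1 : 0 < (v *m w1) 0 0 by apply: usw1; rewrite mem_head.
    set a := (v *m w1) 0 0 in vw1; set b := (v *m w0) 0 0.
    pose e' := Num.min e (a / (`|b| + 1)).
    have d0 : 0 < `|b| + 1 by rewrite ltr_wpDl.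
    have e'0 : 0 < e' by rewrite lt_min e0 divr_gt0.
    exists e'; split=> // v'; rewrite inE => /predU1P[->|v'us].
      rewrite mulmxDZE -/a -/b.
      have : e' * `|b| < a.
        apply: (@le_lt_trans _ _ (a / (`|b| + 1) * `|b|)).
          by rewrite ler_wpM2r // ge_min lexx orbT.
        by rewrite mulrAC ltr_pdivrMr // ltr_pM2l // ltrDl ltr01.
      have : - (e' * `|b|) <= e' * b.
        by rewrite -mulrN ler_wpM2l ?(ltW e'0) // lerNl -normrN ler_norm.
      lra.
    have v'w1 : 0 < (v' *m w1) 0 0 by apply: usw1; rewrite inE v'us orbT.
    move: v'w1 (He _ v'us).
    rewrite !mulmxDZE.
    move: ((v' *m w1) 0 0) ((v' *m w0) 0 0) => x y x0 xy.
    have le_e : e' <= e by rewrite ge_min lexx.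
    have [y0|y0] := leP 0 y; first by rewrite ltr_pwDl // mulr_ge0 // ltW.
    by apply: lt_le_trans xy _; rewrite lerD2l ler_wnM2r // ltW.
  exists (w1 + e *: w0); split.
    by rewrite mulmxDr -scalemxAr Vw1 Vw0 scaler0 addr0.
  move=> v; rewrite inE => /predU1P[->|/He] //.
  by rewrite mulmxDr -scalemxAr uw1 add0r mxE mulr_gt0.
- right; have [D zE] := submxP zV.
  rewrite -(hsubmxK D) mul_row_col in zE.
  set a := lsubmx D in zE; set b := rsubmx D in zE.
  have bE : b *m u = b 0 0 *: u by rewrite {1}[b]mx11_scalar mul_scalar_mx.
  rewrite bE in zE.
  have b0 : b 0 0 < 0.
    move: zw; rewrite zE mulmxDl -mulmxA Vw mulmx0 add0r -scalemxAl mxE => bw.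
    by rewrite ltNge; apply: contraTN bw => b0; rewrite -leNgt mulr_ge0_le0.
  exists (z + (- b 0 0) *: u); split; first by apply/CD/CZ; rewrite ?oppr_gt0.
  by rewrite zE scaleNr addrK submxMl.
Qed.

(** * Extension of characters of lattices *)

(** The graph of a homomorphism from a subgroup of A to the units of K. *)
Record character_graph (A : zmodType) (K : fieldType) (H : A -> K -> Prop) : Prop :=
  CharacterGraph {
    char_neq0 : forall x a, H x a -> a != 0;
    char0 : H 0 1;
    charB : forall x y a b, H x a -> H y b -> H (x - y) (a / b);
    char_fun : forall a, H 0 a -> a = 1 }.

Section CharacterTheory.
Variables (A : zmodType) (K : closedFieldType) (H : A -> K -> Prop).
Hypothesis cH : character_graph H.

Lemma charN x a : H x a -> H (- x) a^-1.
Proof. by move=> Hx; have := charB cH (char0 cH) Hx; rewrite sub0r div1r. Qed.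

Lemma charD x y a b : H x a -> H y b -> H (x + y) (a * b).
Proof. by move=> Hx /charN Hy; have := charB cH Hx Hy; rewrite opprK invrK. Qed.

Lemma charMn x a k : H x a -> H (x *+ k) (a ^+ k).
Proof.
move=> Hx; elim: k => [|k IHk]; first exact: char0 cH.
by rewrite mulrS exprS; apply: charD.
Qed.

Lemma charMz x a (k : int) : H x a -> H (x *~ k) (a ^ k).
Proof.
move=> Hx; case: k => k; first exact: charMn.
by rewrite NegzE mulrNz -exprnN; apply/charN/charMn.
Qed.

Lemma char_inj x a b : H x a -> H x b -> a = b.
Proof.
move=> Ha Hb; have := charB cH Ha Hb; rewrite subrr => /(char_fun cH)/divr1_eq //.
Qed.

(** The smallest positive multiple d e on which the character is defined generates all
of them; a d-th root of its value serves as the value at e.  If no positive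
multiple is in the domain, the value 1 does. *)
Lemma char_root e : exists2 c : K, c != 0 &
  forall (k : int) b, H (e *~ k) b -> b = c ^ k.
Proof.
have [[d [d0 [b Hb]]]|none] := pselect (exists d, (0 < d)%N /\ exists b, H (e *+ d) b); last first.
  exists 1; rewrite ?oner_neq0 // => k b Hkb; rewrite exp1rz.
  case: k Hkb => [[|k]|k] Hkb; first by rewrite mulr0z in Hkb; apply: (char_fun cH).
    by case: none; exists k.+1; split=> //; exists b.
  case: none; exists k.+1; split=> //; exists b^-1.
  by have := charN Hkb; rewrite NegzE mulrNz opprK.
have exd : exists d, (0 < d)%N && `[< exists b, H (e *+ d) b >].
  by exists d; rewrite d0; apply/asboolP; exists b.
have [{d0 Hb b}d /andP[d0 /asboolP[b Hb]] dmin] := ex_minnP exd.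
have [c] : exists c, root ('X^d - b%:P) c.
  by apply/closed_rootP; rewrite size_XnsubC // eqSS -lt0n.
rewrite rootE hornerD hornerN hornerXn hornerC subr_eq0 => /eqP cd.
have c0 : c != 0.
  by apply: contra_eq_neq cd => ->; rewrite expr0n gtn_eqF // eq_sym (char_neq0 cH Hb).
exists c => // k a Hk.
have kE := divz_eq k d; set q := (k %/ d)%Z in kE; set r := (k %% d)%Z in kE.
have Hq : H (e *~ (q * d)) (b ^ q).
  by rewrite mulrC mulrzA; apply: charMz; apply: Hb.
have Hr : H (e *~ r) (a / b ^ q).
  have -> : r = k - q * d by rewrite {1}kE addrC addKr.
  by rewrite mulrzBr; apply: (charB cH).
have r0 : r = 0.
  have dn0 : (d%:Z != 0) by rewrite eqz_nat -lt0n.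
  have := modz_ge0 k dn0; have := ltz_mod k dn0; rewrite -/r.
  case: r Hr {kE} => // -[//|m] Hm; rewrite ltz_nat => lt_md _.
  suff : (d <= m.+1)%N by rewrite leqNgt lt_md.
  by apply: dmin; apply/asboolP; eexists; apply: Hm.
move: Hr; rewrite r0 mulr0z => /(char_fun cH)/divr1_eq ->.
by rewrite {1}kE r0 addr0 -cd exprnP exprz_exp mulrC.
Qed.

Lemma char_extend1 e : exists H' : A -> K -> Prop,
  [/\ character_graph H', forall x a, H x a -> H' x a & exists c, H' e c].
Proof.
have [c c0 cP] := char_root e.
exists (fun x a => exists (k : int) b, H (x - e *~ k) b /\ a = b * c ^ k).
split; last 1 first.
- by exists c, 1, 1; rewrite subrr mul1r; split=> //; apply: char0 cH.
- split.
  + by move=> x _ [k [b [Hb ->]]]; rewrite mulf_neq0 ?(char_neq0 cH Hb) ?expfz_neq0.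
  + by exists 0, 1; rewrite mulr0z subr0 mulr1; split=> //; apply: char0 cH.
  + move=> x y _ _ [k [b [Hb ->]]] [l [d [Hd ->]]]; exists (k - l), (b / d); split.
      by have := charB cH Hb Hd; congr H;
         rewrite mulrzBr !opprB addrACA [RHS]addrACA [- _ - _]addrC.
    by rewrite expfzDr // invfM invr_expz mulrACA.
  + move=> _ [k [b [Hb ->]]]; have := charN Hb; rewrite sub0r opprK => /cP <-.
    by rewrite mulfV ?(char_neq0 cH Hb).
- by move=> x a Ha; exists 0, a; rewrite mulr0z subr0 mulr1.
Qed.

End CharacterTheory.

(** The unit vectors are added to the domain one at a time.  This uses only that the
unit group of an algebraically closed field is divisible. *)
Lemma character_extension (n : nat) (K : closedFieldType) (H : 'rV[int]_n -> K -> Prop) :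
  character_graph H ->
  exists y : 'I_n -> K, (forall i, y i != 0) /\
    forall x a, H x a -> a = \prod_i y i ^ x 0 i.
Proof.
move=> cH.
have [H' [cH' sH H'e]] : exists H' : 'rV[int]_n -> K -> Prop,
  [/\ character_graph H', forall x a, H x a -> H' x a &
      forall i, i \in enum 'I_n -> exists c, H' (delta_mx 0 i) c].
  elim: (enum 'I_n) => [|i s [H1 [cH1 sH1 IH]]]; first by exists H; split.
  have [H2 [cH2 sH2 Hi]] := char_extend1 cH1 (delta_mx 0 i).
  exists H2; split=> // [x a Hx|j]; first exact/sH2/sH1.
  by rewrite inE => /predU1P[->//|/IH[c Hc]]; exists c; apply: sH2.
have /choice[y yP] : forall i, exists c, H' (delta_mx 0 i) c.
  by move=> i; apply: H'e; rewrite mem_enum.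
exists y; split=> [i|x a /sH Ha]; first exact: (char_neq0 cH' (yP i)).
have := char_inj cH' Ha; apply.
rewrite [x in H' x]matrix_sum_delta big_ord1.
elim/big_rec2: _ => [|i b z _ Hz]; first exact: char0 cH'.
apply: (charD cH') Hz.
suff -> : x 0 i *: delta_mx 0 i = (delta_mx 0 i : 'rV[int]_n) *~ x 0 i by apply: charMz.
by rewrite -scaler_int intz.
Qed.

(** * Places on Laurent monomials *)

Definition expvec n (m : 'X_{1..n}) : 'rV[int]_n := \row_i (m i)%:Z.

Lemma exists_total_min (T : eqType) (r : T -> T -> Prop) (s : seq T) : s != [::] ->
  (forall x, r x x) -> (forall x y z, r x y -> r y z -> r x z) ->
  (forall x y, x \in s -> y \in s -> r x y \/ r y x) ->
  exists2 x, x \in s & forall y, y \in s -> r x y.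
Proof.
move=> s0 rr rt; elim: s s0 => // x [|x' s] IHs _ tot.
  by exists x; rewrite ?mem_head // => y; rewrite inE => /eqP->.
have [y z ys zs|y ys ymin] := IHs isT.
  by apply: tot; rewrite in_cons ?ys ?zs orbT.
have [||xy|yx] := tot x y; rewrite ?mem_head //; first by rewrite in_cons ys orbT.
  by exists x; rewrite ?mem_head // => z; rewrite in_cons => /predU1P[->//|/ymin]; apply: rt.
exists y; first by rewrite in_cons ys orbT.
by move=> z; rewrite in_cons => /predU1P[->//|/ymin].
Qed.

(** The values that a place gives to Laurent monomials; g : 'rV[int]_n is an exponent
vector and V g c means that x ^ g is in the domain with value c. *)
Record monomial_place (K : fieldType) (n : nat) (V : 'rV[int]_n -> K -> Prop) : Prop := {
  mono_place0 : V 0 1;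
  mono_placeD : forall g d a b, V g a -> V d b -> V (g + d) (a * b);
  mono_place_inj : forall g a b, V g a -> V g b -> a = b }.

Section Laurent.
Variables (K : closedFieldType) (n k : nat) (F : 'I_k -> {mpoly K[n]}).
Variables (E : fieldType) (phi : {rmorphism {mpoly K[n]} -> E}).
Hypothesis phi_inj : injective phi.

Definition laurent_mono (g : 'rV[int]_n) : E := \prod_i phi 'X_i ^ g 0 i.
Local Notation xg := laurent_mono.

Lemma phiX_neq0 m : phi 'X_[m] != 0.
Proof.
apply/eqP; rewrite -(rmorph0 phi) => /phi_inj /(congr1 (mcoeff m)).
by rewrite mcoeffX eqxx mcoeff0 => /eqP; rewrite oner_eq0.
Qed.

Lemma laurent_monoD g d : xg (g + d) = xg g * xg d.
Proof.
by rewrite -big_split; apply: eq_bigr => i _; rewrite mxE expfzDr ?phiX_neq0.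
Qed.

Lemma laurent_mono0 : xg 0 = 1.
Proof. by apply: big1 => i _; rewrite mxE. Qed.

Lemma laurent_monoE m : xg (expvec m) = phi 'X_[m].
Proof. by rewrite mpolyXE_id rmorph_prod; apply: eq_bigr => i _; rewrite mxE rmorphXn. Qed.

Definition is_laurent (x : E) := exists a p, x * phi 'X_[a] = phi p.
Definition laurent_ideal (x : E) :=
  exists a b, x * phi 'X_[a] = phi (\sum_j b j * F j).
Local Notation R := is_laurent.
Local Notation J := laurent_ideal.

Lemma is_laurentD x y : R x -> R y -> R (x + y).
Proof.
move=> [a [p xa]] [b [q yb]]; exists (a + b)%MM, (p * 'X_[b] + q * 'X_[a]).
by rewrite mpolyXD !rmorphD !rmorphM /= -xa -yb; ring.
Qed.

Lemma is_laurentM x y : R x -> R y -> R (x * y).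
Proof.
move=> [a [p xa]] [b [q yb]]; exists (a + b)%MM, (p * q).
by rewrite mpolyXD !rmorphM /= -xa -yb; ring.
Qed.

Lemma laurent_idealM x y : R x -> J y -> J (x * y).
Proof.
move=> [a [p xa]] [b [q yb]]; exists (a + b)%MM, (fun j => p * q j).
rewrite mpolyXD rmorphM mulrACA xa yb -rmorphM mulr_sumr.
by congr (phi _); apply: eq_bigr => j _; rewrite mulrA.
Qed.

Lemma laurent_idealD x y : J x -> J y -> J (x + y).
Proof.
move=> [a [p xa]] [b [q yb]]; exists (a + b)%MM, (fun j => p j * 'X_[b] + q j * 'X_[a]).
have -> : \sum_j (p j * 'X_[b] + q j * 'X_[a]) * F j =
    (\sum_j p j * F j) * 'X_[b] + (\sum_j q j * F j) * 'X_[a].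
  by rewrite !mulr_suml -big_split /=; apply: eq_bigr => j _; ring.
by rewrite mpolyXD !rmorphD !rmorphM /= -xa -yb; ring.
Qed.

Lemma is_laurent_mono g : R (xg g).
Proof.
pose a := [multinom absz (g 0 i)%R | i < n]; pose b := [multinom absz (g 0 i + `|g 0 i|)%R | i < n].
exists a, 'X_[b]; rewrite -!laurent_monoE -laurent_monoD; congr xg.
by apply/rowP => i; rewrite !mxE !mnmE abszE gez0_abs // -lerBlDl sub0r -normrN ler_norm.
Qed.

Lemma laurent_monoMN g : xg g * xg (- g) = 1.
Proof. by rewrite -laurent_monoD subrr laurent_mono0. Qed.

(** The hypothesis says that evaluation at p0 kills the elements of the Laurent ideal
of F that are polynomials.  It is extended until, of two monomials of the F j, one
divides the other in the domain.  Then some monomial m0 of F j divides all the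
others, and F j / x ^ m0 is an element of the ideal in the domain: its value is 0. *)
Lemma monomial_place_exists (p0 : 'I_n -> K) :
  (forall a u, (exists b, 'X_[a] * u = \sum_j b j * F j) -> u.@[p0] = 0) ->
  exists V : 'rV[int]_n -> K -> Prop,
    [/\ monomial_place V,
        forall i, V (delta_mx 0 i) (p0 i),
        forall j, F j != 0 -> exists2 m0, m0 \in msupp (F j) &
          forall m, m \in msupp (F j) -> exists c, V (expvec m - expvec m0) c
      & forall j m0 (c : 'X_{1..n} -> K),
          (forall m, m \in msupp (F j) -> V (expvec m - expvec m0) (c m)) ->
          \sum_(m <- msupp (F j)) (F j)@_m * c m = 0].
Proof.
move=> F0; pose G0 x c := exists2 p : {mpoly K[n]}, x = phi p & c = p.@[p0].
have pG0 : partial_place R J G0.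
  split.
  - by move=> _ _ [p -> _]; exists 0%MM, p; rewrite mpolyX0 rmorph1 mulr1.
  - move=> _ _ [p -> ->] [a [b]]; rewrite -rmorphM => /phi_inj pab.
    by apply: (F0 a); exists b; rewrite mulrC.
  - by exists 1; rewrite ?rmorph1 ?meval1.
  - by move=> _ _ _ _ [p -> ->] [q -> ->]; exists (p - q); rewrite ?rmorphB ?mevalB.
  - by move=> _ _ _ _ [p -> ->] [q -> ->]; exists (p * q); rewrite ?rmorphM ?mevalM.
  - by move=> a; exists (phi a%:MP), a%:MP; rewrite ?mevalC.
pose ms := flatten [seq msupp (F j) | j <- enum 'I_k].
pose ts (mm : 'X_{1..n} * 'X_{1..n}) := xg (expvec mm.1 - expvec mm.2).
pose ss (mm : 'X_{1..n} * 'X_{1..n}) := xg (expvec mm.2 - expvec mm.1).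
have [mm|G [pG sG GE]] := place_extend_seq is_laurentD is_laurentM laurent_idealM
    laurent_idealD (ts := ts) (ss := ss) [seq (m, m') | m <- ms, m' <- ms] pG0.
  split; [|exact: is_laurent_mono..].
  by rewrite /ss -opprB laurent_monoMN.
exists (fun g c => G (xg g) c); split.
- split.
  + by rewrite laurent_mono0; apply: place1 pG.
  + by move=> g d a b Ga Gb; rewrite laurent_monoD; apply: (placeM pG).
  + move=> g a b Ga Gb; apply/eqP; rewrite -subr_eq0; apply/eqP.
    apply: (place_kill pG (placeB pG Ga Gb)); rewrite subrr.
    exists 0%MM, (fun _ => 0); rewrite mul0r big1 ?rmorph0 // => j _; exact: mul0r.
- move=> i; apply: sG; exists 'X_i; last by rewrite mevalXU.
  rewrite -laurent_monoE; congr xg; apply/rowP => l.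
  by rewrite !mxE mnm1E eqxx /= eq_sym; case: eqP.
- move=> j Fj0; apply: (exists_total_min
    (r := fun m0 m => exists c, G (xg (expvec m - expvec m0)) c)).
  + by rewrite msupp_eq0.
  + by move=> m; exists 1; rewrite subrr laurent_mono0; apply: place1 pG.
  + move=> m1 m2 m3 [c Gc] [d Gd]; exists (c * d).
    by rewrite -(subrKA (expvec m2)) addrC laurent_monoD mulrC [c * d]mulrC; apply: (placeM pG).
  + have inms m : m \in msupp (F j) -> m \in ms.
      move=> mF; apply/flattenP; exists (msupp (F j)) => //.
      by apply/mapP; exists j; rewrite ?mem_enum.
    move=> m1 m2 /inms m1F /inms m2F.
    have [|c [Gc|Gc]] := GE (m2, m1); first by apply/allpairsP; exists (m2, m1).
      by left; exists c.
    by right; exists c.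
- move=> j m0 c Gc.
  have Gsum : G (\sum_(m <- msupp (F j)) phi ((F j)@_m)%:MP * xg (expvec m - expvec m0))
                (\sum_(m <- msupp (F j)) (F j)@_m * c m).
    rewrite big_seq [X in G _ X]big_seq; apply: (place_sum pG) => m mF.
    apply: (placeM pG (sG _ _ _) (Gc m mF)).
    by exists ((F j)@_m)%:MP; rewrite ?mevalC.
  apply: (place_kill pG Gsum); exists m0, (fun l => (l == j)%:R).
rewrite [in RHS](bigD1 j) //= eqxx mul1r [in RHS]big1 => [|l /negbTE->]; last by rewrite mul0r.
  rewrite addr0 [in RHS](mpolyE (F j)) rmorph_sum mulr_suml; apply: eq_bigr => m _.
  by rewrite -mulrA -laurent_monoE -laurent_monoD subrK laurent_monoE -rmorphM mul_mpolyC.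
Qed.

End Laurent.

(** * From a place to a weight and a torus point *)

Lemma primitive_weights n (I : {set 'I_n}) (mu : 'I_n -> nat) : I != finset.set0 ->
  (forall i, (0 < mu i)%N = (i \in I)) ->
  exists k nu, [/\ (0 < k)%N, weights I nu & forall i, mu i = (k * nu i)%N].
Proof.
move=> /set0Pn[i0 i0I] muI; pose k := \big[gcdn/0%N]_(i in I) mu i.
have kdvd i : i \in I -> (k %| mu i)%N by move=> iI; apply: (biggcdn_inf i).
have k0 : (0 < k)%N by apply: dvdn_gt0 (kdvd _ i0I); rewrite muI.
have muE i : mu i = (k * (mu i %/ k))%N.
  have [iI|iI] := boolP (i \in I); first by rewrite mulnC divnK ?kdvd.
  by move: (muI i); rewrite (negbTE iI) lt0n => /negbFE/eqP->; rewrite div0n muln0.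
exists k, (fun i => mu i %/ k)%N; split=> //; split=> [i|].
  by rewrite -muI {2}muE muln_gt0 k0.
apply/eqP; rewrite -(eqn_pmul2l k0) muln1; apply/eqP; rewrite {2}/k.
rewrite (big_morph (muln k) (muln_gcdr k) (muln0 k)).
by apply: eq_bigr => i _; rewrite -muE.
Qed.

Lemma common_denominator n (w : 'I_n -> rat) :
  exists2 d : nat, (0 < d)%N & exists z : 'I_n -> int, forall i, d%:Q * w i = (z i)%:~R.
Proof.
exists (\prod_i `|denq (w i)|)%N.
  by apply: prodn_gt0 => i; rewrite absz_gt0 denq_neq0.
exists (fun i => (\prod_(j | j != i) `|denq (w j)|)%N%:Z * numq (w i)) => i.
rewrite (bigD1 i) //= PoszM abszE gtr0_norm ?denq_gt0 // !intrM numqE; ring.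
Qed.

Lemma pos_weights n (w : 'I_n -> rat) : (forall i, 0 < w i) ->
  exists (q : nat) (mu : 'I_n -> nat), [/\ (0 < q)%N, forall i, (0 < mu i)%N &
    forall i, (mu i)%:R = q%:R * w i].
Proof.
move=> w0; have [q q0 [z zE]] := common_denominator w.
have z0 i : 0 < z i by rewrite -(ltr0z rat) -zE mulr_gt0 ?ltr0n.
exists q, (fun i => `|z i|%N); split=> // i; first by rewrite absz_gt0 gt_eqF.
by rewrite zE -[in RHS](gtz0_abs (z0 i)).
Qed.

Section MonomialPlace.
Variables (K : closedFieldType) (n : nat) (V : 'rV[int]_n -> K -> Prop).
Hypothesis pV : monomial_place V.

Lemma mono_placeMn g c k : V g c -> V (g *+ k) (c ^+ k).
Proof.
move=> Vg; elim: k => [|k IHk]; first exact: mono_place0 pV.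
by rewrite mulrS exprS; apply: (mono_placeD pV).
Qed.

Local Notation toQ := (map_mx (intr : int -> rat)).

Let toQ_inj : injective (toQ : 'rV[int]_n -> 'rV[rat]_n).
Proof.
by move=> x y /rowP xy; apply/rowP => i; have /eqP := xy i; rewrite !mxE eqr_int => /eqP.
Qed.

Let toQMn (g : 'rV[int]_n) k : toQ (g *+ k) = k%:R *: toQ g.
Proof. by rewrite raddfMn /= scaler_nat. Qed.

(** Rational multiples of the exponents of those Laurent monomials that are quotients of
monomials of nonzero value. *)
Definition unit_direction (z : 'rV[rat]_n) := exists (q : nat) g1 g2 c1 c2,
  [/\ (0 < q)%N, V g1 c1, V g2 c2, c1 * c2 != 0 & q%:R *: z = toQ g1 - toQ g2].

Lemma unit_directionD x y :
  unit_direction x -> unit_direction y -> unit_direction (x + y).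
Proof.
move=> [q [g1 [g2 [c1 [c2 [q0 V1 V2 c0 xE]]]]]].
move=> [r [h1 [h2 [d1 [d2 [r0 W1 W2 d0 yE]]]]]].
exists (q * r)%N, (g1 *+ r + h1 *+ q), (g2 *+ r + h2 *+ q).
exists (c1 ^+ r * d1 ^+ q), (c2 ^+ r * d2 ^+ q); split.
- by rewrite muln_gt0 q0.
- by apply: (mono_placeD pV); apply: mono_placeMn.
- by apply: (mono_placeD pV); apply: mono_placeMn.
- by rewrite mulrACA -!exprMn mulf_neq0 // expf_neq0.
- rewrite !map_mxD !toQMn natrM scalerDr [in LHS]mulrC -scalerA xE.
  rewrite [r%:R * q%:R]mulrC -scalerA yE !scalerBr opprD !addrA.
  by congr (_ - _); rewrite addrAC.
Qed.

Lemma unit_directionN x : unit_direction x -> unit_direction (- x).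
Proof.
move=> [q [g1 [g2 [c1 [c2 [q0 V1 V2 c0 xE]]]]]].
by exists q, g2, g1, c2, c1; rewrite mulrC scalerN xE opprB.
Qed.

Lemma unit_directionZ (a : rat) x : unit_direction x -> unit_direction (a *: x).
Proof.
wlog a0 : a x / 0 <= a => [hw Hx|].
  have [/hw|/ltW a0] := leP 0 a; first exact.
  by rewrite -[a]opprK scaleNr -scalerN; apply: hw (unit_directionN Hx); rewrite oppr_ge0.
move=> [q [g1 [g2 [c1 [c2 [q0 V1 V2 c0 xE]]]]]].
have [k kE] : exists k : nat, numq a = k by exists `|numq a|%N; rewrite gez0_abs ?numq_ge0.
have [d dE] : exists d : nat, denq a = d by exists `|denq a|%N; rewrite gez0_abs ?denq_ge0.
exists (d * q)%N, (g1 *+ k), (g2 *+ k), (c1 ^+ k), (c2 ^+ k); split.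
- by rewrite muln_gt0 q0 andbT -ltz_nat -dE denq_gt0.
- exact: mono_placeMn.
- exact: mono_placeMn.
- by rewrite -exprMn expf_neq0.
- rewrite !toQMn -scalerBr -xE !scalerA natrM; congr (_ *: _).
  have -> : k%:R = a * d%:R :> rat by have := numqE a; rewrite kE dE.
  by ring.
Qed.

(** The tropical half of a place: a linear form that is positive where the value is 0
and vanishes where it is a unit.  If there were none, [motzkin] would give a
positive combination of exponents of value 0 that is a unit direction, and the same
monomial would have both value 0 and a nonzero value. *)
Lemma place_weights (L : seq 'rV[int]_n) :
  (forall g, g \in L -> exists c, V g c) ->
  exists w : 'I_n -> int, forall g c, g \in L -> V g c ->
    if c == 0 then is_true (0 < \sum_i g 0 i * w i) else \sum_i g 0 i * w i = 0.
Proof.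
move=> VL.
pose vs := [seq g <- L | `[< exists2 c, c != 0 & V g c >]].
pose us := [seq g <- L | `[< V g 0 >]].
pose A : 'M[rat]_(size vs, n) := \matrix_(i < size vs) toQ (nth 0 vs i).
pose C z := exists (q : nat) g, [/\ (0 < q)%N, V g 0 & q%:R *: z = toQ g].
have [|||[w [Aw usw]]|[z [[q [g [q0 Vg zE]]] zA]]] := @motzkin n (map toQ us) C _ A.
- move=> x y [q [g [q0 Vg xE]]] [r [h [r0 Vh yE]]].
  exists (q * r)%N, (g *+ r + h *+ q); split; first by rewrite muln_gt0 q0.
    have -> : 0 = 0 ^+ r * 0 ^+ q :> K by rewrite [0 ^+ q]expr0n gtn_eqF // mulr0.
    by apply: (mono_placeD pV); apply: mono_placeMn.
  rewrite !map_mxD !toQMn -xE -yE scalerDr !scalerA -!natrM.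
  by rewrite [(r * q)%N]mulnC.
- move=> a x a0 [q [g [q0 Vg xE]]].
  have [k kE] : exists k : nat, numq a = k by exists `|numq a|%N; rewrite gez0_abs ?numq_ge0 ?ltW.
  have [d dE] : exists d : nat, denq a = d by exists `|denq a|%N; rewrite gez0_abs ?denq_ge0.
  have k0 : (0 < k)%N by rewrite -ltz_nat -kE numq_gt0.
  exists (d * q)%N, (g *+ k); split; first by rewrite muln_gt0 q0 andbT -ltz_nat -dE denq_gt0.
    by have := mono_placeMn k Vg; rewrite expr0n gtn_eqF.
  rewrite toQMn -xE !scalerA natrM; congr (_ *: _).
  have -> : k%:R = a * d%:R :> rat by have := numqE a; rewrite kE dE.
  by ring.
- move=> _ /mapP[g + ->]; rewrite mem_filter => /andP[/asboolP Vg _].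
  by exists 1%N, g; rewrite scale1r.
- have [d d0 [z zE]] := common_denominator (fun i => w i 0).
  exists z => g c gL Vg.
  have sumE : (\sum_i g 0 i * z i)%:~R = d%:R * (toQ g *m w) 0 0.
    rewrite mxE rmorph_sum mulr_sumr; apply: eq_bigr => i _.
    by rewrite rmorphM /= -zE mxE; ring.
  have [c0|c0] := eqVneq c 0.
    rewrite -(ltr0z rat) sumE mulr_gt0 ?ltr0n // usw //; apply: map_f.
    by rewrite mem_filter gL andbT; apply/asboolP; rewrite -c0.
  have gvs : g \in vs by rewrite mem_filter gL andbT; apply/asboolP; exists c.
  have iP : (index g vs < size vs)%N by rewrite index_mem.
  have AE : (A *m w) (Ordinal iP) 0 = (toQ g *m w) 0 0.
    by rewrite !mxE; apply: eq_bigr => i _; rewrite !mxE nth_index.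
  by apply/eqP; rewrite -(intr_eq0 rat) sumE -AE Aw mxE mulr0.
(* clearing denominators, a monomial of value 0 times one of nonzero value is a
   monomial of nonzero value *)
- have [D zD] := submxP zA.
  have : unit_direction z.
    rewrite zD mulmx_sum_row; elim/big_ind: _ => [|x y|i _].
    - exists 1%N, 0, 0, 1, 1; rewrite mul1r oner_neq0 scaler0 subrr.
      by split=> //; apply: mono_place0 pV.
    - exact: unit_directionD.
    - apply: unit_directionZ; rewrite rowK.
      have := mem_nth 0 (ltn_ord i); rewrite mem_filter => /andP[/asboolP[c c0 Vc] _].
      exists 1%N, (nth 0 vs i), 0, c, 1; rewrite mulr1 scale1r map_mx0 subr0.
      by split=> //; apply: mono_place0 pV.
  move=> [r [g1 [g2 [c1 [c2 [r0 V1 V2 c0 zE']]]]]].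
  have gE : g *+ r + g2 *+ q = g1 *+ q.
    apply: toQ_inj; rewrite map_mxD !toQMn -zE scalerA mulrC -scalerA zE' scalerBr subrK.
    by [].
  have := mono_place_inj pV (mono_placeD pV (mono_placeMn r Vg) (mono_placeMn q V2)).
  rewrite gE expr0n gtn_eqF // mul0r => /(_ _ (mono_placeMn q V1))/esym/eqP.
  by rewrite expf_eq0 q0; move: c0; rewrite mulf_eq0 negb_or => /andP[/negbTE->].
Qed.

(** The toric half of a place: its nonzero values define a character of a sublattice,
which extends to all exponents, that is, to a point of the torus. *)
Lemma place_point :
  exists y : 'I_n -> K, (forall i, y i != 0) /\
    forall g c, V g c -> c != 0 -> c = \prod_i y i ^ g 0 i.
Proof.
pose H g c := exists g1 g2 c1 c2,
  [/\ V g1 c1, V g2 c2, c1 * c2 != 0, g = g1 - g2 & c = c1 / c2].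
have [|y [y0 yP]] := @character_extension n K H.
  have V0 := mono_place0 pV; split.
  - move=> _ _ [g1 [g2 [c1 [c2 [_ _ c0 _ ->]]]]].
    by move: c0; rewrite !mulf_eq0 invr_eq0.
  - by exists 0, 0, 1, 1; rewrite subrr divr1 mul1r oner_neq0.
  - move=> _ _ _ _ [g1 [g2 [c1 [c2 [V1 V2 c0 -> ->]]]]] [h1 [h2 [d1 [d2 [W1 W2 e0 -> ->]]]]].
    exists (g1 + h2), (g2 + h1), (c1 * d2), (c2 * d1); split.
    + exact: (mono_placeD pV).
    + exact: (mono_placeD pV).
    + by rewrite mulrACA [d2 * _]mulrC mulf_neq0.
    + by rewrite opprB opprD addrACA.
    + by rewrite invfM invrK invfM [d1^-1 * _]mulrC mulrACA.
  - move=> _ [g1 [g2 [c1 [c2 [V1 V2 c0 /esym/eqP + ->]]]]].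
    rewrite subr_eq0 => /eqP gE; rewrite gE in V1.
    move: c0; rewrite (mono_place_inj pV V1 V2) mulf_eq0 orbb => c0.
    exact: mulfV.
exists y; split=> // g c Vg c0; apply: yP; exists g, 0, c, 1.
by rewrite mulr1 divr1 subr0; split=> //; apply: mono_place0 pV.
Qed.

End MonomialPlace.

Lemma expvecB_sum n (m m0 : 'X_{1..n}) (nu : 'I_n -> nat) :
  \sum_i (expvec m - expvec m0) 0 i * (nu i)%:Z = (wdeg nu m)%:Z - (wdeg nu m0)%:Z.
Proof.
rewrite !rmorph_sum /= -sumrB; apply: eq_bigr => i _.
by rewrite !mxE !PoszM; ring.
Qed.

(** The base point is 0 in the coordinates of I and 1 elsewhere, so that the weight is
positive exactly on I.  The weight and the torus point come from a place of
[monomial_place_exists].  The terms of F j of nonzero relative value are those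
of minimal weight, so the vanishing of the value of F j / x ^ m0 says that the
initial form vanishes at the point. *)
Lemma tropical_zero (K : closedFieldType) (n k : nat) (F : 'I_k -> {mpoly K[n]})
    (I : {set 'I_n}) : I != finset.set0 ->
  (forall a u, (exists b, 'X_[a] * u = \sum_j b j * F j) ->
     u.@[fun i => (i \notin I)%:R] = 0) ->
  exists nu, weights I nu /\
    exists y, torus [set: 'I_n] y /\ forall j, (weight_initial nu (F j)).@[y] = 0.
Proof.
have frac_inj : injective (@tofrac {mpoly K[n]}) by move=> p q /eqP; rewrite tofrac_eq => /eqP.
move=> I0 HF; have [V [pV Vp Vmin Vkill]] :=
  monomial_place_exists frac_inj HF.
have /choice[m0 m0P] : forall j, exists m0, F j != 0 -> m0 \in msupp (F j) /\
    forall m, m \in msupp (F j) -> exists c, V (expvec m - expvec m0) c.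
  move=> j; have [->|Fj0] := eqVneq (F j) 0; first by exists 0%MM.
  by have [m0 m0F m0P] := Vmin j Fj0; exists m0.
have /choice[val valP] : forall g, exists c, (exists c', V g c') -> V g c.
  by move=> g; have [[c Vc]|no] := pselect (exists c, V g c); [exists c|exists 0].
pose L := [seq delta_mx 0 i | i <- enum 'I_n] ++
  flatten [seq [seq expvec m - expvec (m0 j) | m <- msupp (F j)] | j <- enum 'I_k].
have suppnz j m : m \in msupp (F j) -> F j != 0.
  by move=> mF; rewrite -msupp_eq0; case: (msupp _) mF.
have VL g : g \in L -> exists c, V g c.
  rewrite mem_cat => /orP[/mapP[i _ ->]|/flattenP[_ /mapP[j _ ->] /mapP[m mF ->]]].
    by eexists; apply: Vp.
  by have [_] := m0P j (suppnz _ _ mF); apply.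
have [w wP] := place_weights pV VL.
have wi i : if i \in I then is_true (0 < w i) else w i = 0.
  have dL : delta_mx 0 i \in L by rewrite mem_cat map_f ?mem_enum.
  have := wP _ _ dL (Vp i).
  have -> : \sum_j (delta_mx 0 i : 'rV[int]_n) 0 j * w j = w i.
    rewrite (bigD1 i) //= big1 => [|j /negbTE ji]; rewrite !mxE eqxx ?eqxx ?mul1r ?addr0 //.
    by rewrite ji mul0r.
  by case: (i \in I) => /=; rewrite ?eqxx ?oner_eq0.
have wE i : w i = `|w i|%N by have := wi i; case: ifP => _ => [/gtz0_abs|->].
have [i|q [nu [q0 nuI nuE]]] := @primitive_weights n I (fun i => `|w i|%N) I0.
  by have := wi i; case: ifP => _ => [/lt0r_neq0|->] //; rewrite absz_gt0.
(* the weight ranks the monomials of F j as the place does *)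
exists nu; split=> //.
have nuP j m : m \in msupp (F j) ->
    if val (expvec m - expvec (m0 j)) == 0 then is_true (wdeg nu (m0 j) < wdeg nu m)%N
    else wdeg nu m = wdeg nu (m0 j).
  move=> mF; set g := expvec m - _.
  have gL : g \in L.
    rewrite mem_cat; apply/orP; right; apply/flattenP.
    by eexists; [apply: map_f; rewrite mem_enum|apply: map_f].
  have := wP _ _ gL (valP _ (VL _ gL)).
  have -> : \sum_i g 0 i * w i = q%:Z * ((wdeg nu m)%:Z - (wdeg nu (m0 j))%:Z).
    rewrite -expvecB_sum mulr_sumr; apply: eq_bigr => i _.
    by rewrite wE nuE PoszM; ring.
  case: ifP => _.
    by rewrite pmulr_rgt0 ?ltz_nat // subr_gt0 ltz_nat.
  by move/eqP; rewrite mulf_eq0 eqz_nat gtn_eqF //= subr_eq0 => /eqP[].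
have [y [y0 yP]] := place_point pV.
exists y; split=> [i|j]; first by rewrite y0 finset.in_setT.
have [->|Fj0] := eqVneq (F j) 0.
  by rewrite /weight_initial msupp0 big_nil meval0.
have [m0F VF] := m0P j Fj0.
rewrite /weight_initial rmorph_sum /= -[RHS](mulr0 (\prod_i y i ^+ m0 j i)).
rewrite -[in RHS](Vkill j (m0 j) (fun m => val (expvec m - expvec (m0 j)))); last first.
  by move=> m mF; apply/valP/VF.
pose minimal m := all (fun m' => (wdeg nu m <= wdeg nu m')%N) (msupp (F j)).
rewrite mulr_sumr big_seq_cond [RHS]big_seq_cond [RHS](bigID minimal) /=.
rewrite [X in _ = _ + X]big1 => [|m]; last first.
  rewrite andbT => /andP[mF]; apply: contraNeq.
  rewrite !mulf_eq0 !negb_or => /and3P[_ _ vm].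
  apply/allP => m' m'F; have := nuP _ _ mF; rewrite (negbTE vm) => ->.
  by have := nuP _ _ m'F; case: ifP => _ => [/ltnW|->].
rewrite addr0; apply: eq_big => [m|m /andP[mF /allP mmin]]; first by rewrite andbT.
have vm : val (expvec m - expvec (m0 j)) != 0.
  by have := nuP _ _ mF; have := mmin _ m0F; case: eqP => // _; rewrite leqNgt => /negbTE->.
rewrite mevalZ mevalX mulrCA; congr (_ * _).
rewrite (yP _ _ (valP _ (VF _ mF)) vm) -big_split /=; apply: eq_bigr => i _.
by rewrite !mxE !exprnP -expfzDr // addrCA subrr addr0.
Qed.

(** * Ideals and quotients of finite dimension *)

Section Ideals.
Variable A : comNzRingType.

Record is_ideal (J : A -> Prop) : Prop := IsIdeal {
  ideal0 : J 0;
  idealD : forall a b, J a -> J b -> J (a + b);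
  idealM : forall c a, J a -> J (c * a) }.

Lemma idealB J : is_ideal J -> forall a b, J a -> J b -> J (a - b).
Proof. by move=> iJ a b Ja Jb; apply: (idealD iJ) => //; rewrite -mulN1r; apply: (idealM iJ). Qed.

Lemma ideal_prod J I (r : seq I) (P : pred I) (F G : I -> A) : is_ideal J ->
  (forall i, P i -> J (F i - G i)) ->
  J (\prod_(i <- r | P i) F i - \prod_(i <- r | P i) G i).
Proof.
move=> iJ FG; elim/big_rec2: _ => [|i x y Pi IH].
  by rewrite subrr; apply: ideal0.
have -> : F i * y - G i * x = y * (F i - G i) + G i * (y - x) by ring.
by apply: (idealD iJ); apply: (idealM iJ) => //; apply: FG.
Qed.

Lemma gen_ideal_is_ideal n (g : 'I_n -> A) : is_ideal (gen_ideal g).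
Proof.
split.
- by exists (fun _ => 0); rewrite big1 // => i _; rewrite mul0r.
- move=> _ _ [a ->] [b ->]; exists (fun i => a i + b i).
  by rewrite -big_split; apply: eq_bigr => i _; rewrite mulrDl.
- move=> c _ [a ->]; exists (fun i => c * a i).
  by rewrite mulr_sumr; apply: eq_bigr => i _; rewrite mulrA.
Qed.

Variables (n : nat) (x : 'I_n -> A) (J : A -> Prop).
Hypothesis iJ : is_ideal J.

(** Membership in the ideal J + (x_k : k not in I). *)
Definition add_vars (I : {set 'I_n}) (h : A) : Prop :=
  exists b : 'I_n -> A, J (h - \sum_(k | k \notin I) b k * x k).

Lemma add_vars_ideal I : is_ideal (add_vars I).
Proof.
split.
- exists (fun _ => 0); rewrite big1 ?subr0; first exact: ideal0.
  by move=> k _; rewrite mul0r.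
- move=> a b [s Js] [t Jt]; exists (fun k => s k + t k).
  have -> : \sum_(k | k \notin I) (s k + t k) * x k =
      \sum_(k | k \notin I) s k * x k + \sum_(k | k \notin I) t k * x k.
    by rewrite -big_split /=; apply: eq_bigr => k _; rewrite mulrDl.
  by rewrite opprD addrACA; apply: (idealD iJ).
- move=> c a [s Js]; exists (fun k => c * s k).
  have -> : \sum_(k | k \notin I) c * s k * x k = c * \sum_(k | k \notin I) s k * x k.
    by rewrite mulr_sumr; apply: eq_bigr => k _; rewrite mulrA.
  by rewrite -mulrBr; apply: (idealM iJ).
Qed.

(** The ring-theoretic form of the fact that a prime ideal containing J contains all
x_i: otherwise let I be the set of the x_i that it does not contain; it contains
J + (x_k : k not in I), hence a power of the product of the x_i, i in I.  By
induction on the size of I, for each l in I a power of x_i is congruent to a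
multiple of x_l, and these congruences are multiplied together. *)
Lemma nilpotent_vars :
  (forall I, I != finset.set0 -> exists N, add_vars I ((\prod_(i in I) x i) ^+ N)) ->
  forall i, exists N, J (x i ^+ N).
Proof.
move=> HI i; suff /(_ finset.setT)[N [b Jb]] : forall I, exists N, add_vars I (x i ^+ N).
  by exists N; move: Jb; rewrite big_pred0 ?subr0 // => k; rewrite finset.in_setT.
move=> I; have [m] := ubnP #|I|; elim: m I => // m IHm I sI.
have [->|I0] := eqVneq I finset.set0.
  exists 1, (fun k => (k == i)%:R); rewrite (bigD1 i) ?finset.in_set0 //= eqxx mul1r.
  rewrite big1 ?addr0 ?subrr; first exact: ideal0.
  by move=> k /andP[_ /negbTE->]; rewrite mul0r.
have iI := add_vars_ideal I.
have /choice[Nb NbP] : forall l, exists Nb : nat * A,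
    l \in I -> add_vars I (x i ^+ Nb.1 - Nb.2 * x l).
  move=> l; have [lI|] := boolP (l \in I); last by exists (0%N, 0).
  have [|N [b Jb]] := IHm (I :\ l)%SET.
    by apply: leq_trans (_ : #|I| <= m)%N; rewrite // [X in (_ < X)%N](cardsD1 l) lI.
  exists (N, b l) => _; exists b; move: Jb; congr J; rewrite -addrA; congr (_ + _).
  rewrite (bigD1 l) /=; last by rewrite !inE eqxx.
  rewrite opprD; congr (_ - _); apply: eq_bigl => k.
  by rewrite !inE negb_and negbK; case: eqVneq => [->|]; rewrite ?lI ?andbF ?andbT.
have [N HN] := HI I I0.
exists (\sum_(l in I) (Nb l).1 * N)%N.
have -> : x i ^+ (\sum_(l in I) (Nb l).1 * N) = (\prod_(l in I) x i ^+ (Nb l).1) ^+ N.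
  by rewrite prodrXr -exprM big_distrl.
set P := \prod_(l in I) _ in HN *; set Q := \prod_(l in I) _.
have JQ : add_vars I (Q - \prod_(l in I) ((Nb l).2 * x l)) by apply: ideal_prod.
have -> : Q ^+ N = (Q ^+ N - (\prod_(l in I) ((Nb l).2 * x l)) ^+ N) +
     (\prod_(l in I) (Nb l).2) ^+ N * P ^+ N.
  by rewrite -exprMn -big_split /= subrK.
apply: (idealD iI); last exact: (idealM iI).
have := @ideal_prod _ 'I_N (index_enum _) xpredT (fun=> Q)
  (fun=> \prod_(l in I) ((Nb l).2 * x l)) iI.
by rewrite !prodr_const !card_ord; apply.
Qed.

End Ideals.

Section QuotientDim.
Variables (K : fieldType) (V : lmodType K) (J : set V).
Hypotheses (JD : forall a b, J a -> J b -> J (a + b))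
  (JZ : forall (c : K) a, J a -> J (c *: a)).

(** A spanning family of minimal size is a basis. *)
Lemma quotient_dim_finite (R : realType) d (e : 'I_d -> V) :
  (forall v, exists c : 'I_d -> K, J (v - \sum_i c i *: e i)) ->
  (quotient_dim R J < +oo)%E.
Proof.
move=> eP; pose spans d := `[< exists e : 'I_d -> V,
  forall v, exists c : 'I_d -> K, J (v - \sum_i c i *: e i) >].
have exd : exists d, spans d by exists d; apply/asboolP; exists e.
have [{d e eP exd}d /asboolP[e eP] dmin] := ex_minnP exd.
suff eB : quotient_basis J e.
  apply: (@le_lt_trans _ _ (d%:R%:E)); last exact: ltry.
  by apply: ereal_inf_lbound; exists d => //; exists e.
split=> // c Jc i; apply: contrapT => /eqP ci0.
case: d e eP dmin c i Jc ci0 => [|d] e eP dmin c i Jc ci0; first by case: i {ci0}.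
have := dmin d; rewrite ltnn => /(_ _)/negP; apply=> //.
apply/asboolP; exists (fun k => e (lift i k)) => v.
have [a Ja] := eP v; exists (fun k => a (lift i k) - a i / c i * c (lift i k)).
have := JD Ja (JZ (a i / c i) Jc); congr J.
rewrite -addrA; congr (_ + _); rewrite scaler_sumr.
rewrite (bigD1_ord i) //= (bigD1_ord i (P := xpredT)) //=.
rewrite scalerA divfK // opprD addrACA addNr add0r -sumrN -big_split -sumrN /=.
by apply: eq_bigr => k _; rewrite scalerBl scalerA opprB addrC.
Qed.

End QuotientDim.

(** * Power series *)

Section Series.
Variables (n : nat) (K : comNzRingType).
Implicit Types (a b s : mseries n K) (p q : {mpoly K[n]}).
Local Notation ser := (@mser_of_mpoly n K).

Lemma mserM a b m : (a * b) m =
  \sum_(k : 'X_{1..n < (mdeg m).+1, (mdeg m).+1} | m == (k.1 + k.2)%MM) a k.1 * b k.2.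
Proof. by []. Qed.

Lemma mser1 m : (1 : mseries n K) m = (m == 0%MM)%:R.
Proof. by []. Qed.

Lemma mser_sum I (r : seq I) (P : pred I) (F : I -> mseries n K) m :
  (\sum_(i <- r | P i) F i) m = \sum_(i <- r | P i) F i m.
Proof. by elim/big_rec2: _ => // i x y _ <-. Qed.

Lemma mser_of_mpoly_is_zmod_morphism : zmod_morphism ser.
Proof. by move=> p q; apply/funext => m; exact: mcoeffB. Qed.

Lemma mser_of_mpoly_is_monoid_morphism : monoid_morphism ser.
Proof.
split=> [|p q]; apply/funext => m; first exact: mcoeff1.
exact: mcoeffM.
Qed.

HB.instance Definition _ := GRing.isZmodMorphism.Build {mpoly K[n]} (mseries n K) ser
  mser_of_mpoly_is_zmod_morphism.
HB.instance Definition _ := GRing.isMonoidMorphism.Build {mpoly K[n]} (mseries n K) ser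
  mser_of_mpoly_is_monoid_morphism.

Lemma mserM_eq a a' b b' d :
  (forall m, mdeg m <= d -> a m = a' m)%N -> (forall m, mdeg m <= d -> b m = b' m)%N ->
  forall m, (mdeg m <= d)%N -> (a * b) m = (a' * b') m.
Proof.
move=> aa bb m md; rewrite !mserM; apply: eq_bigr => k /eqP/(congr1 mdeg); rewrite mdegD => mE.
by rewrite aa ?bb //; lia.
Qed.

Lemma mserM_ord a b d e :
  (forall m, (mdeg m < d)%N -> a m = 0) -> (forall m, (mdeg m < e)%N -> b m = 0) ->
  forall m, (mdeg m < d + e)%N -> (a * b) m = 0.
Proof.
move=> a0 b0 m md; rewrite mserM big1 // => k /eqP/(congr1 mdeg); rewrite mdegD => mE.
have [lt|le] := ltnP (mdeg k.1) d; first by rewrite a0 ?mul0r.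
rewrite [b _]b0 ?mulr0 //.
by rewrite -(ltn_add2l (mdeg k.1)) -mE (leq_trans md) // leq_add2r.
Qed.

(** A series without constant term has powers of growing order, which makes the
geometric series of [mser_inverse] a finite sum in each degree. *)
Lemma mserX_ord a d : a 0%MM = 0 -> forall m, (mdeg m < d)%N -> (a ^+ d) m = 0.
Proof.
move=> a0; elim: d => // d IHd m; rewrite exprS -[d.+1]add1n.
by apply: mserM_ord => // k; rewrite ltnS leqn0 mdeg_eq0 => /eqP->.
Qed.

Lemma mser_monoM (c : 'X_{1..n}) s m :
  (ser 'X_[c] * s) m = if (c <= m)%MM then s (m - c)%MM else 0.
Proof.
have -> : (ser 'X_[c] * s) m = ('X_[c] * mser_trunc (mdeg m).+1 s)@_m.
  rewrite -[RHS]/(ser _ m) rmorphM /=; apply: (mserM_eq (d := mdeg m)) => // k kd.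
  by rewrite /mser_of_mpoly mcoeff_mpoly.
have [le|nle] := boolP (c <= m)%MM.
  rewrite mulrC -{1}(submK le) addmC mcoeffMX mcoeff_mpoly //.
  by rewrite ltnS mdegB.
apply/memN_msupp_eq0; rewrite mulrC (perm_mem (msuppMX _ _)).
by apply: contra nle => /mapP[k _ ->]; rewrite lem_addr.
Qed.

End Series.

Lemma mser_inverse n (K : fieldType) (u : mseries n K) : u 0%MM != 0 ->
  exists v, u * v = 1.
Proof.
move=> u0; suff [v uv] : exists v, ((u 0%MM)^-1 *: u) * v = 1.
  exists ((u 0%MM)^-1 *: v); rewrite -uv; apply/funext => m; rewrite !mserM.
  by apply: eq_bigr => k _; rewrite !mserZ mulrCA mulrA.
set u1 := _ *: u; pose w := 1 - u1.
have w0 : w 0%MM = 0.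
  rewrite -[LHS]/((1 : mseries n K) 0%MM - ((u 0%MM)^-1 *: u) 0%MM).
  by rewrite mserZ mulVf // mser1 eqxx subrr.
exists (fun m => (\sum_(d < (mdeg m).+1) w ^+ d) m); apply/funext => m.
rewrite (mserM_eq (a' := 1 - w) (b' := \sum_(d < (mdeg m).+1) w ^+ d) (d := mdeg m)) //.
- have -> : (1 - w) * \sum_(d < (mdeg m).+1) w ^+ d = 1 - w ^+ (mdeg m).+1.
    by rewrite -opprB mulNr -subrX1 opprB.
  rewrite -[LHS]/((1 : mseries n K) m - (w ^+ (mdeg m).+1) m).
  by rewrite mserX_ord // subr0.
- by move=> k _; rewrite /w subKr.
- move=> k km; rewrite !mser_sum -!(big_mkord xpredT (fun d => (w ^+ d) k)).
  rewrite [RHS](big_cat_nat (n := (mdeg k).+1)) //= [X in _ = _ + X]big_nat_cond.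
  rewrite [X in _ = _ + X]big1 ?addr0 // => d; rewrite andbT => /andP[kd _].
  by rewrite mserX_ord.
Qed.

Section FiniteQuotient.
Variables (n : nat) (K : fieldType) (J : set (mseries n K)).
Hypothesis iJ : is_ideal J.
Local Notation ser := (@mser_of_mpoly n K).

Lemma mserZE (c : K) (a : mseries n K) : c *: a = ser c%:MP * a.
Proof.
apply/funext => m; rewrite mserZ.
have -> : ser c%:MP = c *: ser 'X_[0%MM].
  by apply/funext => k; rewrite mserZ /mser_of_mpoly mcoeffC mcoeffX eq_sym.
rewrite -[a in LHS]mul1r -[1](rmorph1 ser) -mpolyX0 !mserM mulr_sumr.
by apply: eq_bigr => k _; rewrite mserZ mulrA.
Qed.

(** A monomial outside the box is a multiple of some x_i ^ N; [pick] assigns it to one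
such i. *)
Lemma mono_decomposition (h : mseries n K) N :
  exists s : 'I_n -> mseries n K, h =
   \sum_(a : {ffun 'I_n -> 'I_N}) h [multinom (a i : nat) | i < n] *:
     ser 'X_[[multinom (a i : nat) | i < n]]
   + \sum_i s i * ser 'X_i ^+ N.
Proof.
pose pk (m : 'X_{1..n}) := [pick i | (N <= m i)%N].
pose s i : mseries n K :=
  fun m => if pk (m + U_(i) *+ N)%MM == Some i then h (m + U_(i) *+ N)%MM else 0.
exists s; apply/funext => m; rewrite -[RHS]/(_ m + _ m) !mser_sum.
have -> : \sum_(i < n) (s i * ser 'X_i ^+ N) m =
   \sum_(i < n) (if pk m == Some i then h m else 0).
  apply: eq_bigr => i _; rewrite -rmorphXn mpolyXn mulrC mser_monoM.
  case: ifP => [le|nle]; first by rewrite /s submK.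
  rewrite /pk; case: pickP => [j le|//]; case: eqP => // -[ji].
  case/mnm_lepP: nle => l; rewrite mulmnE mnm1E -ji.
  by case: eqP => [<-|]; rewrite ?mul1n ?mul0n.
rewrite (eq_bigr (fun a : {ffun 'I_n -> 'I_N} =>
   h m * (m == [multinom (a i : nat) | i < n])%:R)); last first.
  move=> a _; rewrite mserZ /mser_of_mpoly mcoeffX eq_sym.
  by case: eqP => [->//|]; rewrite !mulr0.
rewrite /pk; case: pickP => [j le|lt].
  rewrite big1 => [|a _].
    rewrite add0r (bigD1 j) //= eqxx big1 ?addr0 // => i ij.
    by rewrite (inj_eq Some_inj) eq_sym (negbTE ij).
  case: eqP => [mE|]; last by rewrite mulr0.
  by move: le; rewrite mE mnmE leqNgt ltn_ord.
rewrite [X in _ + X]big1 // addr0.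
have ltm i : (m i < N)%N by rewrite ltnNge lt.
pose a0 := [ffun i => Ordinal (ltm i)].
rewrite (bigD1 a0) //= big1 ?addr0 => [|a /negP aa0].
  suff -> : m == [multinom (a0 i : nat) | i < n] by rewrite mulr1.
  by apply/eqP/mnmP => i; rewrite mnmE ffunE.
case: eqP => [mE|]; last by rewrite mulr0.
case: aa0; apply/eqP/ffunP => i; apply/val_inj; rewrite ffunE /= mE mnmE.
by [].
Qed.

(** The monomials of a large box span the quotient. *)
Lemma quotient_dim_powers (R : realType) :
  (forall i, exists N, J (ser 'X_i ^+ N)) -> (quotient_dim R J < +oo)%E.
Proof.
move=> /choice[N JN]; pose M := (\sum_i N i)%N.
have JM i : J (ser 'X_i ^+ M).
  have /subnK <- : (N i <= M)%N by rewrite /M (bigD1 i) //= leq_addr.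
  by rewrite exprD; apply: (idealM iJ).
pose T := {ffun 'I_n -> 'I_M}.
pose mono (a : T) : mseries n K := ser 'X_[[multinom (a i : nat) | i < n]].
apply: (@quotient_dim_finite K (mseries n K) J _ _ R #|T| (fun i => mono (enum_val i))).
- exact: (idealD iJ).
- by move=> c a Ja; rewrite mserZE; apply: (idealM iJ).
- move=> h; have [s hE] := mono_decomposition h M.
  exists (fun i => h [multinom ((enum_val i : T) j : nat) | j < n]).
  have hE' : h = \sum_(i < #|T|) h [multinom ((enum_val i : T) j : nat) | j < n] *:
      mono (enum_val i) + \sum_i s i * ser 'X_i ^+ M.
    rewrite [LHS]hE; congr (_ + _); rewrite (reindex (@enum_val T xpredT)) //.
    by exists enum_rank => i _; rewrite ?enum_valK ?enum_rankK.
  rewrite [X in J (X - _)]hE' addrAC subrr add0r; elim/big_ind: _ => [|a b Ja Jb|i _].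
  + exact: (ideal0 iJ).
  + exact: (idealD iJ).
  + exact: (idealM iJ).
Qed.

End FiniteQuotient.

(** * Restriction to coordinate subspaces and the finiteness criterion *)

Definition supported n (I : {set 'I_n}) (m : 'X_{1..n}) :=
  [forall k, (k \notin I) ==> (m k == 0%N)].

Lemma supportedP n (I : {set 'I_n}) (m : 'X_{1..n}) :
  reflect (forall k, k \notin I -> m k = 0%N) (supported I m).
Proof.
apply: (iffP forallP) => [H k kI|H k]; first by have /implyP/(_ kI)/eqP := H k.
by apply/implyP => kI; rewrite H.
Qed.

Lemma supported0 n (I : {set 'I_n}) (m : 'X_{1..n}) k : supported I m -> k \notin I -> m k = 0%N.
Proof. by move=> /supportedP; apply. Qed.

Lemma not_supported n (I : {set 'I_n}) (m : 'X_{1..n}) :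
  ~~ supported I m -> exists2 k, k \notin I & (0 < m k)%N.
Proof.
rewrite negb_forall => /existsP[k]; rewrite negb_imply -lt0n => /andP[kI mk].
by exists k.
Qed.

Lemma supportedD n (I : {set 'I_n}) (m m' : 'X_{1..n}) :
  supported I (m + m') = supported I m && supported I m'.
Proof.
apply/supportedP/andP => [H|[/supportedP H /supportedP H'] k kI].
  by split; apply/supportedP => k /H; rewrite mnmDE; lia.
by rewrite mnmDE H ?H'.
Qed.

Lemma supportedU n (I : {set 'I_n}) j : supported I U_(j) = (j \in I).
Proof.
apply/supportedP/idP => [H|jI k kI].
  by apply: contraT => /H; rewrite mnm1E eqxx.
by rewrite mnm1E; case: eqP => // jk; rewrite -jk jI in kI.
Qed.

Section Restriction.
Variables (K : fieldType) (n : nat) (I : {set 'I_n}).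
Implicit Types (p g : {mpoly K[n]}).

Lemma restrict_coordX m :
  restrict_coord I 'X_[K, m] = if supported I m then 'X_[m] else 0.
Proof.
rewrite /restrict_coord comp_mpolyX.
have [/supportedP mI|/not_supported[k kI mk]] := boolP (supported I m).
  rewrite mpolyXE_id; apply: eq_bigr => i _; rewrite tnth_mktuple.
  by case: ifP => // /negbT/mI->; rewrite !expr0.
by rewrite (bigD1 k) //= tnth_mktuple (negbTE kI) expr0n gtn_eqF // mul0r.
Qed.

Lemma restrict_coordE g : restrict_coord I g =
  \sum_(m <- msupp g) g@_m *: (if supported I m then 'X_[m] else 0).
Proof.
rewrite {1}[g]mpolyE {1}/restrict_coord raddf_sum; apply: eq_bigr => m _.
by rewrite /= linearZ /= -[_ \mPo _]/(restrict_coord I _) restrict_coordX.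
Qed.

Lemma mcoeff_restrict g m :
  (restrict_coord I g)@_m = if supported I m then g@_m else 0.
Proof.
rewrite restrict_coordE raddf_sum /=.
have [mg|mg] := boolP (m \in msupp g); last first.
  rewrite (memN_msupp_eq0 mg) if_same big_seq big1 // => k kg.
  rewrite mcoeffZ; case: ifP; rewrite ?mcoeff0 ?mulr0 // mcoeffX.
  by case: eqP => [kE|]; rewrite ?mulr0 //; rewrite -kE kg in mg.
rewrite (bigD1_seq m) ?msupp_uniq //= big1 => [|k /negbTE km].
  by rewrite addr0 mcoeffZ; case: ifP => _; rewrite ?mcoeff0 ?mulr0 // mcoeffX eqxx mulr1.
by rewrite mcoeffZ; case: ifP => _; rewrite ?mcoeff0 ?mulr0 // mcoeffX km mulr0.
Qed.

Lemma meval_restrict g (x : 'I_n -> K) :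
  (restrict_coord I g).@[x] = g.@[fun i => if i \in I then x i else 0].
Proof.
rewrite comp_mpoly_meval; apply: meval_eq => i; rewrite tnth_mktuple.
by case: ifP; rewrite ?mevalXU ?meval0.
Qed.

Definition ones_off p : {mpoly K[n]} :=
  p \mPo [tuple (if i \in I then 'X_i else 1) | i < n].

Lemma ones_offX m :
  ones_off 'X_[m] = 'X_[[multinom (if i \in I then m i else 0%N) | i < n]].
Proof.
rewrite /ones_off comp_mpolyX mpolyXE_id; apply: eq_bigr => i _.
by rewrite tnth_mktuple mnmE; case: ifP => _; rewrite ?expr1n ?expr0.
Qed.

Lemma ones_off_restrict g : ones_off (restrict_coord I g) = restrict_coord I g.
Proof.
rewrite restrict_coordE {1}/ones_off raddf_sum; apply: eq_bigr => m _.
rewrite /= linearZ /= -[_ \mPo _]/(ones_off _); case: supportedP => mI; last first.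
  by rewrite /ones_off raddf0.
rewrite ones_offX; congr (_ *: 'X_[_]); apply/mnmP => i; rewrite mnmE.
by case: ifP => // /negbT/mI.
Qed.

Lemma ones_off_comb k (b g : 'I_k -> {mpoly K[n]}) :
  ones_off (\sum_j b j * restrict_coord I (g j)) =
  \sum_j ones_off (b j) * restrict_coord I (g j).
Proof.
rewrite {1}/ones_off (raddf_sum (comp_mpoly _)); apply: eq_bigr => j _.
by rewrite /= rmorphM /= -/(ones_off _) -/(ones_off _) ones_off_restrict.
Qed.

Lemma mcoeff0_ones_off p : (ones_off p)@_0%MM = p.@[fun i => (i \notin I)%:R].
Proof.
have ev0 (q : {mpoly K[n]}) : q@_0%MM = q.@[fun=> 0].
  rewrite mevalE {1}[q]mpolyE raddf_sum /=; apply: eq_bigr => m _.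
  rewrite mcoeffZ mcoeffX; congr (_ * _); case: eqP => [->|/eqP m0].
    by rewrite big1 // => i _; rewrite mnm0E.
  have [i mi] : exists i, m i != 0%N.
    apply: contrapT => H; case/eqP: m0; apply/mnmP => i; rewrite mnm0E.
    by apply: contrapT => /eqP mi; apply: H; exists i.
  by rewrite (bigD1 i) //= expr0n (negbTE mi) mul0r.
rewrite ev0 comp_mpoly_meval; apply: meval_eq => i; rewrite tnth_mktuple.
by case: (i \in I); rewrite ?mevalXU ?meval1.
Qed.

End Restriction.

Local Notation ser := mser_of_mpoly.

(** Suppose that the quotient is infinite dimensional.  By [nilpotent_vars], for some I
no monomial in the variables of I lies in the ideal generated by the g j and the
other variables, and [tropical_zero] gives a weight and a torus point at which all
initial forms vanish.  The unit u of [tropical_zero] becomes invertible among the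
power series after the other variables are set to 1. *)
Theorem local_dim_finite (R : realType) (K : closedFieldType) n
    (g : 'I_n -> {mpoly K[n]}) :
  (forall I, I != finset.set0 -> forall nu, weights I nu ->
     ~ exists2 x, torus [set: 'I_n] x &
         forall j, (weight_initial nu (restrict_coord I (g j))).@[x] = 0) ->
  (local_dim R g < +oo)%E.
Proof.
move=> Hg; pose J := gen_ideal (fun j => ser (g j)).
have iJ : is_ideal J by apply: gen_ideal_is_ideal.
have Jg j : J (ser (g j)).
  exists (fun l => (l == j)%:R); rewrite (bigD1 j) //= eqxx mul1r big1 ?addr0 //.
  by move=> l /negbTE->; rewrite mul0r.
apply: quotient_dim_powers => //; apply: nilpotent_vars => // I I0.
set JI := add_vars _ _ _; have iJI : is_ideal JI by apply: add_vars_ideal.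
have J_JI h : J h -> JI h.
  move=> Jh; exists (fun=> 0); rewrite big1 ?subr0 // => k _; exact: mul0r.
have var_JI k : k \notin I -> JI (ser 'X_k).
  move=> kI; exists (fun l => (l == k)%:R); rewrite (bigD1 k) //= eqxx mul1r.
  rewrite big1 ?addr0 ?subrr; first exact: (ideal0 iJ).
  by move=> l /andP[_ /negbTE->]; rewrite mul0r.
have [a [u [[b abu] u0]]] : exists a u, (exists b, 'X_[a] * u =
    \sum_j b j * restrict_coord I (g j)) /\ u.@[fun i => (i \notin I)%:R] != 0.
  apply: contrapT => H.
  have [|nu [nuI [x [xT x0]]]] := @tropical_zero K n n (fun j => restrict_coord I (g j)) I I0.
    by move=> a u ab; apply: contrapT => /eqP u0; apply: H; exists a, u.
  by apply: (Hg I I0 nu nuI); exists x.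
have restrict_JI h : JI (ser h) -> JI (ser (restrict_coord I h)).
  move=> Jh; rewrite -[restrict_coord I h](subKr h) rmorphB /=; apply: (idealB iJI) => //.
  rewrite restrict_coordE {1}[h]mpolyE -sumrB rmorph_sum.
  elim/big_ind: _ => [|p q Jp Jq|m _]; first exact: (ideal0 iJI).
    exact: (idealD iJI).
  rewrite -scalerBr -mul_mpolyC rmorphM /=; apply: (idealM iJI).
  have [_|/not_supported[k kI mk]] := boolP (supported I m).
    by rewrite subrr rmorph0; apply: (ideal0 iJI).
  rewrite subr0 -(submK (m := U_(k)) (m' := m)) ?lep1mP -?lt0n // mpolyXD rmorphM.
  by apply: (idealM iJI); apply: var_JI.
have [v uv] : exists v, ser (ones_off I u) * v = 1.
  by apply: mser_inverse; rewrite /mser_of_mpoly mcoeff0_ones_off.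
pose aI := [multinom (if i \in I then a i else 0%N) | i < n].
have JaI : JI (ser 'X_[aI]).
  have -> : ser 'X_[aI] = v * ser ('X_[aI] * ones_off I u).
    by rewrite rmorphM /= mulrCA [v * _]mulrC uv mulr1.
  have -> : 'X_[aI] * ones_off I u = ones_off I ('X_[a] * u).
    by rewrite -ones_offX [RHS]rmorphM.
  apply: (idealM iJI); rewrite abu ones_off_comb.
  rewrite rmorph_sum; elim/big_ind: _ => [|p q Jp Jq|j _].
  - exact: (ideal0 iJI).
  - exact: (idealD iJI).
  - rewrite !rmorphM /=; apply: (idealM iJI).
    exact/restrict_JI/J_JI/Jg.
exists (mdeg a).
pose c : 'X_{1..n} := [multinom (if i \in I then mdeg a else 0%N) | i < n].
have -> : (\prod_(i in I) ser 'X_[K, U_(i)]) ^+ mdeg a = ser 'X_[K, c - aI] * ser 'X_[K, aI].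
  have -> : ser 'X_[c - aI] * ser 'X_[aI] = ser 'X_[K, c].
    rewrite -[in RHS](submK (m := aI) (m' := c)) ?mpolyXD ?rmorphM //.
    apply/mnm_lepP => i; rewrite !mnmE; case: ifP => // _.
    by rewrite mdegE (bigD1 i) //= leq_addr.
  rewrite mpolyXE_id rmorph_prod -prodrXl big_mkcond /=; apply: eq_bigr => i _.
  by rewrite mnmE; case: ifP => _; rewrite ?expr0 ?rmorph1 ?rmorphXn.
exact: (idealM iJI).
Qed.

(** * A finite local algebra needs many equations *)

Section SeriesRestriction.
Variables (n : nat) (K : comNzRingType) (I : {set 'I_n}).

Definition ser_restrict (a : mseries n K) : mseries n K :=
  fun m => if supported I m then a m else 0.

Lemma ser_restrictD a b : ser_restrict (a + b) = ser_restrict a + ser_restrict b.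
Proof.
apply/funext => m; rewrite -[RHS]/(ser_restrict a m + ser_restrict b m) /ser_restrict.
by case: ifP; rewrite ?addr0.
Qed.

Lemma ser_restrict0 : ser_restrict 0 = 0.
Proof. by apply/funext => m; rewrite /ser_restrict if_same. Qed.

Lemma ser_restrict_sum J (r : seq J) (P : pred J) F :
  ser_restrict (\sum_(i <- r | P i) F i) = \sum_(i <- r | P i) ser_restrict (F i).
Proof. exact: (big_morph _ ser_restrictD ser_restrict0). Qed.

Lemma ser_restrictZ c a : ser_restrict (c *: a) = c *: ser_restrict a.
Proof.
by apply/funext => m; rewrite mserZ /ser_restrict mserZ; case: ifP; rewrite ?mulr0.
Qed.

Lemma ser_restrictM a b : ser_restrict (a * b) = ser_restrict a * ser_restrict b.
Proof.
apply/funext => m; rewrite mserM /ser_restrict; case: ifP => mI.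
  rewrite mserM; apply: eq_bigr => k /eqP mE.
  by move: mI; rewrite {1}mE supportedD => /andP[-> ->].
rewrite big1 // => k /eqP mE; move: mI; rewrite {1}mE supportedD.
by case: (supported I k.1) => /= [->|_]; rewrite ?mulr0 ?mul0r.
Qed.

End SeriesRestriction.

Lemma ser_restrict_mpoly n (K : fieldType) (I : {set 'I_n}) (p : {mpoly K[n]}) :
  ser_restrict I (ser p) = ser (restrict_coord I p).
Proof. by apply/funext => m; rewrite /ser_restrict /mser_of_mpoly mcoeff_restrict. Qed.

Section Span.
Variables (n : nat) (K : fieldType) (D t : nat) (e : 'I_D -> mseries n K) (h : 'I_t -> mseries n K).

(** Exponents below N suffice modulo order N: when the h k have no constant term, a
product with an exponent N or more has order at least N. *)
Definition gen_mono N (ib : 'I_D * {ffun 'I_t -> 'I_N}) : mseries n K :=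
  e ib.1 * \prod_k h k ^+ ib.2 k.

Definition spanned N (v : mseries n K) := exists C : 'I_D * {ffun 'I_t -> 'I_N} -> K,
  forall m, (mdeg m < N)%N -> v m = \sum_ib C ib * gen_mono ib m.

Lemma spannedD N u v : spanned N u -> spanned N v -> spanned N (u + v).
Proof.
move=> [C Cu] [C' Cv]; exists (fun ib => C ib + C' ib) => m mN.
rewrite mserD Cu // Cv // -big_split; apply: eq_bigr => ib _; exact: esym (mulrDl _ _ _).
Qed.

Lemma spannedZ N c v : spanned N v -> spanned N (c *: v).
Proof.
move=> [C Cv]; exists (fun ib => c * C ib) => m mN.
by rewrite mserZ Cv // mulr_sumr; apply: eq_bigr => ib _; rewrite mulrA.
Qed.

Lemma spanned_ord N v : (forall m, (mdeg m < N)%N -> v m = 0) -> spanned N v.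
Proof.
by move=> v0; exists (fun _ => 0) => m /v0->; rewrite big1 // => ib _; rewrite mul0r.
Qed.

Lemma spanned_sum N J (r : seq J) (P : pred J) F :
  (forall i, P i -> spanned N (F i)) -> spanned N (\sum_(i <- r | P i) F i).
Proof.
move=> FN; elim/big_ind: _ => //; first by apply: spanned_ord.
exact: spannedD.
Qed.

Lemma spanned_gen N i (b : 'I_t -> nat) : (forall k, b k < N)%N ->
  spanned N (e i * \prod_k h k ^+ b k).
Proof.
move=> bN; pose ib := (i, [ffun k => Ordinal (bN k)]).
exists (fun jc => (jc == ib)%:R) => m mN.
rewrite (bigD1 ib) //= eqxx mul1r [X in _ = _ + X]big1 => [|jc /negbTE->]; last by rewrite mul0r.
rewrite addr0; suff -> : gen_mono ib = e i * \prod_k h k ^+ b k by [].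
rewrite /gen_mono /=; congr (_ * _).
by apply: eq_bigr => k _; rewrite ffunE.
Qed.

(** Multiplying by h k raises one exponent by one and the order of the remainder by one;
this drives the induction on N in [finite_system_count]. *)
Lemma spannedMh N v k : h k 0%MM = 0 -> spanned N v -> spanned N.+1 (v * h k).
Proof.
move=> hk0 [C Cv]; pose s : mseries n K := \sum_ib C ib *: gen_mono ib.
have -> : v * h k = s * h k + (v - s) * h k by rewrite -mulrDl addrC subrK.
apply: spannedD.
  rewrite mulr_suml; apply: spanned_sum => -[i b] _.
  rewrite (_ : (C (i, b) *: gen_mono (i, b) : mseries n K) * h k =
      C (i, b) *: (gen_mono (i, b) * h k : mseries n K)); last first.
    by rewrite !mserZE mulrA.
  apply: spannedZ; rewrite /gen_mono /= -mulrA.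
  have -> : (\prod_l h l ^+ b l) * h k = \prod_l h l ^+ (b l + (l == k))%N.
    under [RHS]eq_bigr do rewrite exprD; rewrite big_split /=; congr (_ * _).
    by rewrite (bigD1 k) //= eqxx big1 ?mulr1 // => l /negbTE->.
  apply: spanned_gen => l; have := ltn_ord (b l); case: (l == k); lia.
apply: spanned_ord => m; rewrite -[N.+1]addn1; apply: mserM_ord => {}m.
  move=> mN; rewrite -[LHS]/(v m - s m) Cv // /s mser_sum.
  by apply/eqP; rewrite subr_eq0; apply/eqP/eq_bigr.
by rewrite ltnS leqn0 mdeg_eq0 => /eqP->.
Qed.

End Span.

(** A box of side M in s dimensions outgrows any multiple of a box of side s M in t
dimensions when t < s. *)
Lemma box_growth s t D : (0 < s)%N ->
  (forall M, M.+1 ^ s <= D * (s * M).+1 ^ t)%N -> (s <= t)%N.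
Proof.
move=> s0 HM; rewrite leqNgt; apply/negP => lt_ts.
have := HM (D * s ^ t)%N; set M := (D * s ^ t)%N; apply/negP; rewrite -ltnNge.
apply: (@leq_ltn_trans (D * (s ^ t * M.+1 ^ t))%N).
  rewrite leq_mul2l -expnMn; apply/orP; right.
  have [->|t0] := posnP t; first by rewrite !expn0.
  by rewrite leq_exp2r // mulnS -add1n leq_add2r.
rewrite mulnA -/M; apply: (@leq_trans (M.+1 ^ t.+1)).
  by rewrite expnS ltn_pmul2r ?expn_gt0.
by rewrite leq_pexp2l.
Qed.

(** A substitute for Krull's height theorem.  Let D be the dimension of the local algebra
and h_1, ..., h_t the nonzero restrictions of the g j.  Iterating the division by the
g j, every series in the variables of I is, modulo order N, a combination of the
products e_i h ^ b with the D basis elements e_i and with b in a box of side N.  So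
the independent monomials of a box in #|I| dimensions are at most D * N ^ t in
number, and [box_growth] concludes. *)
Lemma finite_system_count (R : realType) (K : fieldType) n (g : 'I_n -> {mpoly K[n]})
    (I : {set 'I_n}) : (local_dim R g < +oo)%E ->
  I != finset.set0 -> (forall j, (restrict_coord I (g j))@_0%MM = 0) ->
  (#|I| <= #|[set j | restrict_coord I (g j) != 0%R]%SET|)%N.
Proof.
move=> fin I0 g0; set T := [set j | _]%SET.
have [D [e eP]] : exists D (e : 'I_D -> mseries n K), forall v,
    exists c : 'I_D -> K, gen_ideal (fun j => ser (g j)) (v - \sum_i c i *: e i).
  by have [_ [d [e [eP _]] _] _] := ereal_inf_lt fin; exists d, e.
pose e' i := ser_restrict I (e i).
pose h (k : 'I_#|T|) := ser (restrict_coord I (g (enum_val k))).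
have spanI N v : spanned e' h N (ser_restrict I v).
  elim: N v => [|N IHN] v; first by apply: spanned_ord.
  have [c [a va]] := eP v.
  have -> : v = \sum_i c i *: e i + \sum_i a i * ser (g i) by rewrite -va addrC subrK.
  rewrite ser_restrictD !ser_restrict_sum; apply: spannedD; apply: spanned_sum => i _.
    rewrite ser_restrictZ; apply: spannedZ.
    have := @spanned_gen n K D #|T| e' h N.+1 i (fun=> 0%N).
    by rewrite big1 ?mulr1; [apply|move=> k _; rewrite expr0].
  rewrite ser_restrictM ser_restrict_mpoly.
  have [->|gi0] := eqVneq (restrict_coord I (g i)) 0.
    by apply: spanned_ord => m _; rewrite rmorph0 mulr0.
  have iT : i \in T by rewrite inE.
  have := @spannedMh n K D #|T| e' h N (ser_restrict I (a i)) (enum_rank_in iT i).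
  by rewrite /h enum_rankK_in //; apply => //; apply: g0.
apply: (@box_growth _ _ D); first by rewrite card_gt0.
move=> M; set N := (#|I| * M).+1; set s := #|I|.
pose A := {ffun 'I_s -> 'I_M.+1}; pose B := ('I_D * {ffun 'I_#|T| -> 'I_N})%type.
have <- : #|{: A}| = (M.+1 ^ s)%N by rewrite card_ffun !card_ord.
have <- : #|{: B}| = (D * N ^ #|T|)%N by rewrite card_prod card_ffun !card_ord.
have [i0 i0I] : exists i, i \in I by apply/set0Pn.
pose mon (a : A) : 'X_{1..n} :=
  [multinom (if i \in I then (a (enum_rank_in i0I i) : nat) else 0%N) | i < n].
have mon_inj : injective mon.
  move=> a b /mnmP ab; apply/ffunP => k; apply/val_inj.
  have := ab (enum_val k); rewrite !mnmE enum_valP enum_valK_in; exact.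
have mon_deg a : (mdeg (mon a) < N)%N.
  rewrite ltnS mdegE (eq_bigr (fun i => if i \in I then (a (enum_rank_in i0I i) : nat) else 0%N)).
    rewrite -big_mkcond /= -sum_nat_const; apply: leq_sum => i _.
    by rewrite -ltnS.
  by move=> i _; rewrite mnmE.
have mon_supp a : supported I (mon a).
  by apply/supportedP => k /negbTE kI; rewrite mnmE kI.
have /choice[C CP] : forall a, exists C : B -> K,
    forall m, (mdeg m < N)%N -> (m == mon a)%:R = \sum_ib C ib * gen_mono e' h ib m.
  move=> a; have [C CP] := spanI N (ser 'X_[mon a]); exists C => m mN.
  rewrite -CP // /ser_restrict /mser_of_mpoly mcoeffX eq_sym; case: ifP => // mI.
  by case: eqP => // mE; rewrite -mE mon_supp in mI.
pose P : 'M[K]_(#|{: A}|, #|{: B}|) := \matrix_(a, b) C (enum_val a) (enum_val b).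
pose Q : 'M[K]_(#|{: B}|, #|{: A}|) :=
  \matrix_(b, a) gen_mono e' h (enum_val b) (mon (enum_val a)).
apply: (@mulmx1_min _ _ _ P Q); apply/matrixP => a a'; rewrite !mxE.
rewrite -[in RHS](inj_eq enum_val_inj) -(inj_eq mon_inj) eq_sym CP //.
rewrite [RHS](reindex (@enum_val B xpredT)) /=; last first.
  by exists enum_rank => i _; rewrite ?enum_valK ?enum_rankK.
by apply: eq_bigr => b _; rewrite !mxE.
Qed.

(** * Weighted initial parts *)

Lemma wdegD n (nu : 'I_n -> nat) m m' : wdeg nu (m + m')%MM = (wdeg nu m + wdeg nu m')%N.
Proof. by rewrite /wdeg -big_split; apply: eq_bigr => i _; rewrite mnmDE mulnDr. Qed.

Lemma wdegU n (nu : 'I_n -> nat) j : wdeg nu U_(j) = nu j.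
Proof.
rewrite /wdeg (bigD1 j) //= mnm1E eqxx muln1 big1 ?addn0 // => i ij.
by rewrite mnm1E eq_sym (negbTE ij) muln0.
Qed.

Lemma wdeg_scale n (nu mu : 'I_n -> nat) q (m : 'X_{1..n}) :
  (forall i, mu i = q * nu i)%N -> wdeg mu m = (q * wdeg nu m)%N.
Proof.
by move=> muE; rewrite /wdeg big_distrr; apply: eq_bigr => i _; rewrite /= muE mulnA.
Qed.

Lemma exists_nat_min (T : eqType) (s : seq T) (F : T -> nat) : s != [::] ->
  exists2 x, x \in s & forall y, y \in s -> (F x <= F y)%N.
Proof.
move=> s0; apply: (exists_total_min (r := fun x y => is_true (F x <= F y)%N)) => //.
- by move=> x y z; apply: leq_trans.
- by move=> x y _ _; have /orP := leq_total (F x) (F y).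
Qed.

Section Part.
Variables (K : fieldType) (n : nat).
Implicit Types (f g : {mpoly K[n]}) (P Q : pred 'X_{1..n}) (nu : 'I_n -> nat) (m : 'X_{1..n}).

(** Initial forms, face polynomials and weight-homogeneous parts are all of this form. *)
Definition part P g : {mpoly K[n]} := \sum_(m <- msupp g | P m) g@_m *: 'X_[m].

Lemma mcoeff_part P g m : (part P g)@_m = if P m then g@_m else 0.
Proof.
rewrite /part raddf_sum /=.
have [mg|mg] := boolP (m \in msupp g); last first.
  rewrite (memN_msupp_eq0 mg) if_same big_seq_cond big1 // => k /andP[kg _].
  rewrite mcoeffZ mcoeffX; case: eqP => [kE|]; rewrite ?mulr0 //.
  by rewrite -kE kg in mg.
rewrite big_mkcond (bigD1_seq m) ?msupp_uniq //= big1 => [|k /negbTE km].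
  by rewrite addr0 mcoeffZ mcoeffX eqxx mulr1.
by case: ifP => // _; rewrite mcoeffZ mcoeffX km mulr0.
Qed.

Lemma part_eq P Q f g : (forall m, (if P m then f@_m else 0) = (if Q m then g@_m else 0)) ->
  part P f = part Q g.
Proof. by move=> H; apply/mpolyP => m; rewrite !mcoeff_part. Qed.

Lemma initial_part nu g w : (forall m, m \in msupp g -> w <= wdeg nu m)%N ->
  (exists2 m, m \in msupp g & wdeg nu m = w) ->
  weight_initial nu g = part (fun m => wdeg nu m == w) g.
Proof.
move=> gw [m0 m0g m0w]; rewrite /weight_initial -[LHS]/(part _ g).
apply: part_eq => m; have [mg|mg] := boolP (m \in msupp g); last first.
  by rewrite (memN_msupp_eq0 mg) !if_same.
congr (if _ then _ else _); apply/allP/eqP => [H|-> //].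
by apply/eqP; rewrite eqn_leq gw // -m0w H.
Qed.

(** The part of weight w - e is the initial form if that weight is attained, and zero
otherwise.  The shift e keeps the weights of partial derivatives in the naturals. *)
Lemma initial_root nu g w e x : (forall m, m \in msupp g -> w <= wdeg nu m + e)%N ->
  (weight_initial nu g).@[x] = 0 ->
  (part (fun m => wdeg nu m + e == w)%N g).@[x] = 0.
Proof.
move=> gw g0; have [[m mg mw]|none] :=
    pselect (exists2 m, m \in msupp g & (wdeg nu m + e = w)%N); last first.
  suff -> : part (fun m => wdeg nu m + e == w)%N g = 0 by rewrite meval0.
  apply/mpolyP => m; rewrite mcoeff_part mcoeff0; case: eqP => // mw.
  by apply/eqP; rewrite mcoeff_eq0; apply/negP => mg; apply: none; exists m.
rewrite -g0 (@initial_part _ _ (wdeg nu m)); first last.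
- by exists m.
- by move=> m' /gw; rewrite -mw leq_add2r.
congr (_.@[x]); apply: part_eq => m'.
by rewrite -mw eqn_add2r.
Qed.

Lemma mderiv_part nu w f j :
  (part (fun m => wdeg nu m == w) f)^`M(j) =
  part (fun m => wdeg nu m + nu j == w)%N f^`M(j).
Proof.
apply/mpolyP => m; rewrite mcoeff_deriv !mcoeff_part mcoeff_deriv wdegD wdegU.
by case: ifP; rewrite ?mul0rn.
Qed.

Lemma jacobian_zero f x : (forall j, (f^`M(j)).@[x] = 0) ->
  zero_locus (jacobian_ideal f) x.
Proof.
move=> f0 _ [a ->]; rewrite rmorph_sum big1 // => j _.
by rewrite /= mevalM f0 mulr0.
Qed.

Lemma wdeg_supported (I : {set 'I_n}) nu nu' m : supported I m ->
  {in I, nu =1 nu'} -> wdeg nu m = wdeg nu' m.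
Proof.
move=> /supportedP mI nuE; apply: eq_bigr => i _.
by have [/nuE->//|/mI->] := boolP (i \in I); rewrite !muln0.
Qed.

Lemma wdeg_ge nu m k : (0 < m k)%N -> (nu k <= wdeg nu m)%N.
Proof.
by move=> mk; rewrite /wdeg (bigD1 k) //= (leq_trans _ (leq_addr _ _)) // leq_pmulr.
Qed.

Lemma weights_extend (I : {set 'I_n}) nu nu' : weights I nu -> {in I, nu =1 nu'} ->
  (forall i, i \notin I -> 0 < nu' i)%N -> weights [set: 'I_n]%SET nu'.
Proof.
move=> [nuI g1] nuE nu0; split=> [i|].
  rewrite finset.in_setT; have [iI|/nu0->//] := boolP (i \in I).
  by rewrite -nuE // nuI iI.
apply/eqP; rewrite -dvdn1 -g1; apply/dvdn_biggcdP => i iI.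
by rewrite nuE //; apply: (biggcdn_inf i); rewrite ?finset.in_setT.
Qed.

Lemma supp_restrict I g m : (m \in msupp (restrict_coord I g)) =
  supported I m && (m \in msupp g).
Proof. by rewrite !mcoeff_msupp mcoeff_restrict; case: ifP; rewrite ?eqxx. Qed.

Lemma supp_deriv j f m : m \in msupp f^`M(j) -> (m + U_(j))%MM \in msupp f.
Proof.
rewrite !mcoeff_msupp mcoeff_deriv; apply: contraNneq => ->.
by rewrite mul0rn.
Qed.

(** Extended by a large weight off I, nu has as initial form of f the nu-initial form of
the restriction of f to I.  Each of its derivatives is zero or the initial form of
the restricted derivative of f, so x is a zero of its Jacobian ideal. *)
Lemma nondegenerate_restrict f I nu x : newton_nondegenerate f -> weights I nu ->
  restrict_coord I f != 0 -> torus [set: 'I_n]%SET x ->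
  (forall j, (weight_initial nu (restrict_coord I f^`M(j))).@[x] = 0) -> False.
Proof.
move=> ndf nuI fI xT x0.
have fs : msupp (restrict_coord I f) != [::] by rewrite msupp_eq0.
have [m0 m0f m0min] := exists_nat_min (wdeg nu) fs.
set w := wdeg nu m0 in m0min.
pose nu' i := if i \in I then nu i else w.+1.
have nuE : {in I, nu =1 nu'} by move=> i iI; rewrite /nu' iI.
have nuT : weights [set: 'I_n]%SET nu'.
  by apply: weights_extend nuI nuE _ => i /negbTE iI; rewrite /nu' iI.
move: m0f; rewrite supp_restrict => /andP[m0I m0f].
have InE : weight_initial nu' f = part (fun m => wdeg nu' m == w) f.
  apply: initial_part; last by exists m0 => //; rewrite -(wdeg_supported m0I nuE).
  move=> m mf; have [mI|/not_supported[k kI mk]] := boolP (supported I m).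
    by rewrite -(wdeg_supported mI nuE) m0min // supp_restrict mI.
  by apply: ltnW; have := wdeg_ge nu' mk; rewrite {1}/nu' (negbTE kI).
suff : (zero_locus (jacobian_ideal (weight_initial nu' f)) `&` torus [set: 'I_n]%SET)%classic x.
  by rewrite (ndf nu').
split=> //; apply: jacobian_zero => j; rewrite InE mderiv_part.
have [jI|jI] := boolP (j \in I); last first.
  suff -> : part (fun m => wdeg nu' m + nu' j == w)%N f^`M(j) = 0 by rewrite meval0.
  apply/mpolyP => m; rewrite mcoeff_part mcoeff0 /nu' (negbTE jI).
  by case: eqP => //; lia.
rewrite -(@initial_root nu (restrict_coord I f^`M(j)) w (nu j) x) //.
  congr (_.@[x]); apply: part_eq => m; rewrite mcoeff_restrict -nuE //.
  have [mI|nmI] := boolP (supported I m); first by rewrite (wdeg_supported mI nuE).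
  rewrite if_same; case: eqP => // wE.
  have [k kI mk] := not_supported nmI.
  by have := wdeg_ge nu' mk; rewrite {1}/nu' (negbTE kI); lia.
move=> m; rewrite supp_restrict => /andP[mI /supp_deriv mf].
by rewrite -wdegU -wdegD m0min // supp_restrict mf supportedD mI supportedU jI.
Qed.

End Part.

(** * Polynomials that vanish on a coordinate subspace *)

Section Vanishing.
Variables (K : fieldType) (n : nat).
Implicit Types (f g p : {mpoly K[n]}) (nu : 'I_n -> nat) (m : 'X_{1..n}).

Lemma euler_weighted nu w g (x : 'I_n -> K) :
  \sum_i (nu i)%:R * x i * ((part (fun m => wdeg nu m == w) g)^`M(i)).@[x] =
  w%:R * (part (fun m => wdeg nu m == w) g).@[x].
Proof.
set p := part _ _.
have pw m : m \in msupp p -> wdeg nu m = w.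
  by rewrite mcoeff_msupp mcoeff_part; case: (eqVneq (wdeg nu m) w) => // _; rewrite eqxx.
have dE i : (p^`M(i)).@[x] = \sum_(m <- msupp p) p@_m * ((m i)%:R * ('X_[m - U_(i)]).@[x]).
  have -> : p^`M(i) = \sum_(m <- msupp p) p@_m *: ('X_[m])^`M(i).
    by rewrite {1}[p]mpolyE raddf_sum /=; apply: eq_bigr => m _; rewrite mderivZ.
  rewrite (raddf_sum (meval x)); apply: eq_bigr => m _.
  by rewrite /= mevalZ mderivX mevalZ.
rewrite (eq_bigr (fun i => \sum_(m <- msupp p) p@_m * ('X_[m]).@[x] * (nu i * m i)%:R)).
  rewrite exchange_big /= {3}[p]mpolyE raddf_sum mulr_sumr big_seq [RHS]big_seq.
  apply: eq_bigr => m /pw mw; rewrite -mulr_sumr -natr_sum -/(wdeg nu m) mw.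
  by rewrite /= mevalZ mulrC.
move=> i _; rewrite dE mulr_sumr; apply: eq_bigr => m _.
have [->|mi] := eqVneq (m i) 0%N; first by rewrite mul0r muln0 !mulr0.
have -> : 'X_[m] = 'X_[m - U_(i)] * 'X_i :> {mpoly K[n]} by rewrite -mpolyXD submK ?lep1mP.
rewrite mevalM mevalXU natrM; ring.
Qed.

Lemma meval_supported (I : {set 'I_n}) p (x z : 'I_n -> K) :
  (forall m, m \in msupp p -> supported I m) -> {in I, x =1 z} -> p.@[x] = p.@[z].
Proof.
move=> pI xz; rewrite !mevalE big_seq [RHS]big_seq; apply: eq_bigr => m /pI/supportedP mI.
congr (_ * _); apply: eq_bigr => i _.
by have [/xz->//|/mI->] := boolP (i \in I); rewrite !expr0.
Qed.

Lemma mcoeffXM j p m : ('X_j * p)@_m = if (0 < m j)%N then p@_(m - U_(j)) else 0.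
Proof.
case: ifP => [mj|mj].
  by rewrite mulrC -{1}(submK (m := U_(j)) (m' := m)) ?lep1mP -?lt0n // addmC mcoeffMX.
apply: memN_msupp_eq0; rewrite mulrC (perm_mem (msuppMX _ _)).
by apply/negP => /mapP[k _ mE]; move: mj; rewrite mE mnmDE mnm1E eqxx.
Qed.

(** Otherwise M would have full rank i and v would be zero. *)
Lemma left_kernel k i (M : 'M[K]_(k, i)) (v : 'cV_i) :
  (i <= k)%N -> v != 0 -> M *m v = 0 -> exists2 l : 'rV_k, l != 0 & l *m M = 0.
Proof.
move=> ik v0 Mv; have [M0|/rowV0Pn[l /sub_kermxP lM l0]] := eqVneq (kermx M) 0; last by exists l.
have fullM : row_full M.
  rewrite /row_full eqn_leq rank_leq_col (leq_trans ik) //.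
  by rewrite -[X in (X <= _)%N](eqP (_ : row_free M)) // -kermx_eq0 M0.
have [B BM] := row_fullP fullM.
by move/eqP: v0; case; rewrite -[v]mul1mx -BM -mulmxA Mv mulmx0.
Qed.

(** The restrictions h j of the derivatives vanish for j in I.  At the common zero x of
their initial forms H j, Euler's relation makes the gradients of the H j orthogonal
to the vector (nu_i x_i), which is nonzero because the weights have gcd 1.  At least
#|I| of the h j are nonzero, so some combination of their gradients, with
coefficients lam of support S, vanishes.  Weights off I can be chosen such that the
initial form of f becomes the sum of x_j * H j over j in S.  It is singular at the
torus point that extends x by lam, which contradicts non-degeneracy. *)
Lemma nondegenerate_vanishing f (I : {set 'I_n}) nu (x : 'I_n -> K) :
  newton_nondegenerate f -> weights I nu -> I != finset.set0 -> restrict_coord I f = 0 ->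
  (#|I| <= #|[set j | restrict_coord I f^`M(j) != 0%R]%SET|)%N ->
  torus [set: 'I_n]%SET x ->
  (forall j, (weight_initial nu (restrict_coord I f^`M(j))).@[x] = 0) -> False.
Proof.
move=> ndf nuI I0 fI cT xT x0; set T := [set j | _]%SET in cT.
pose h j := restrict_coord I f^`M(j).
have hE j m : (h j)@_m = if supported I m then f@_(m + U_(j)) *+ (m j).+1 else 0.
  by rewrite mcoeff_restrict mcoeff_deriv.
have fU m : supported I m -> f@_m = 0.
  by move=> mI; have := congr1 (mcoeff m) fI; rewrite mcoeff_restrict mI mcoeff0.
have TI j : j \in T -> j \notin I.
  rewrite inE; apply: contraNN => jI; apply/eqP/mpolyP => m; rewrite mcoeff0 hE.
  by case: ifP => // mI; rewrite fU ?mul0rn // supportedD mI supportedU.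
have /choice[d dP] : forall j, exists d,
    (forall m, m \in msupp (h j) -> d <= wdeg nu m)%N.
  move=> j; have [h0|h0] := eqVneq (msupp (h j)) [::]; first by exists 0%N; rewrite h0.
  by have [m _ mP] := exists_nat_min (wdeg nu) h0; exists (wdeg nu m).
have /choice[{dP}d dP] : forall j, exists d,
    (forall m, m \in msupp (h j) -> d <= wdeg nu m)%N /\
    (h j != 0 -> exists2 m, m \in msupp (h j) & wdeg nu m = d).
  move=> j; have [h0|h0] := eqVneq (h j) 0.
    by exists 0%N; split=> [m|]; rewrite // h0 msupp0.
  have hs : msupp (h j) != [::] by rewrite msupp_eq0.
  have [m mh mP] := exists_nat_min (wdeg nu) hs.
  by exists (wdeg nu m); split=> // _; exists m.
pose H j := part (fun m => wdeg nu m == d j) (h j).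
have HE j m : (H j)@_m = if wdeg nu m == d j then (h j)@_m else 0 by rewrite mcoeff_part.
have Hsupp j m : m \in msupp (H j) -> supported I m.
  by rewrite mcoeff_msupp HE hE; case: (supported I m); rewrite // if_same eqxx.
have Hx j : (H j).@[x] = 0.
  rewrite -(@initial_root K n nu (h j) (d j) 0 x); last exact: x0.
    by congr (_.@[x]); apply: part_eq => m; rewrite addn0.
  by move=> m /(proj1 (dP j)); rewrite addn0.
have dH0 j k : k \notin I -> (H j)^`M(k) = 0.
  move=> kI; apply/mpolyP => m; rewrite mcoeff_deriv mcoeff0 HE hE supportedD supportedU.
  by rewrite (negbTE kI) andbF if_same mul0rn.
(* the gradients of the H j at x are dependent, by Euler's relation *)
have [lam [j0 j0T lj0] lamP] : exists2 lam : 'I_n -> K, exists2 j, j \in T & lam j != 0 &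
    forall i, \sum_(j in T) lam j * ((H j)^`M(i)).@[x] = 0.
  pose M : 'M[K]_(#|T|, #|I|) := \matrix_(k, l) ((H (enum_val k))^`M(enum_val l)).@[x].
  pose v : 'cV[K]_(#|I|) := \col_l ((nu (enum_val l))%:R * x (enum_val l)).
  (* a prime characteristic dividing all nu i with i in I would divide their gcd *)
  have v0 : v != 0.
    apply/eqP => v0; have nu0 i : i \in I -> (nu i)%:R = 0 :> K.
      move=> iI; have := congr1 (fun u : 'cV_(#|I|) => u (enum_rank_in iI i) 0) v0.
      rewrite !mxE enum_rankK_in // => /eqP; rewrite mulf_eq0 => /orP[/eqP//|].
      by have := xT i; rewrite finset.in_setT => /negbTE->.
    have [i0 i0I] : exists i, i \in I by apply/set0Pn.
    have [q qK] : exists q, q \in [pchar K].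
      have nu_gt0 : (0 < nu i0)%N by case: nuI => ->.
      by have [q qK] := natf0_pchar nu_gt0 (introT eqP (nu0 _ i0I)); exists q.
    have : (q %| 1)%N.
      case: nuI => _ <-; apply/dvdn_biggcdP => i iI.
      by rewrite (dvdn_pcharf qK) nu0.
    by rewrite dvdn1 => /eqP q1; have := pcharf_prime qK; rewrite q1.
  have Mv : M *m v = 0.
    apply/matrixP => k z; rewrite !mxE.
    transitivity ((d (enum_val k))%:R * (H (enum_val k)).@[x]); last by rewrite Hx mulr0.
    rewrite /H -euler_weighted.
    rewrite (bigID (mem I)) /= [X in _ = _ + X]big1 ?addr0 => [|i iI]; last first.
      by rewrite -/(H (enum_val k)) dH0 // meval0 mulr0.
    by rewrite [RHS]big_enum_val /=; apply: eq_bigr => l _; rewrite !mxE mulrC.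
  have [l l0 lM] := left_kernel cT v0 Mv.
  have [j1 j1T] : exists j, j \in T by apply/set0Pn; rewrite -card_gt0 (leq_trans _ cT) // card_gt0.
  exists (fun j => l 0 (enum_rank_in j1T j)).
    have /rV0Pn[k lk] := l0; exists (enum_val k); first exact: enum_valP.
    by rewrite enum_valK_in.
  move=> i; have [iI|iI] := boolP (i \in I); last first.
    by rewrite big1 // => j _; rewrite dH0 // meval0 mulr0.
  have := congr1 (fun u : 'rV_(#|I|) => u 0 (enum_rank_in iI i)) lM; rewrite !mxE => {2}<-.
  rewrite big_enum_val /=; apply: eq_bigr => k _.
  by rewrite enum_valK_in mxE enum_rankK_in.
pose S := [set j in T | lam j != 0]%SET.
have ST j : j \in S -> j \in T by rewrite inE => /andP[].
have j0S : j0 \in S by rewrite inE j0T.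
(* N exceeds 2 d j, so a monomial with two factors off I has weight above N, while
   x_j times a monomial of weight d j has weight N when j is in S *)
pose N := (\sum_j 2 * d j).+1.
have dN j : (2 * d j < N)%N by rewrite ltnS (bigD1 j) //= leq_addr.
pose nu' i := if i \in I then nu i else if i \in S then (N - d i)%N else (2 * N)%N.
have nuE : {in I, nu =1 nu'} by move=> i iI; rewrite /nu' iI.
have nu'2 k : k \notin I -> (N < 2 * nu' k)%N.
  by move=> /negbTE kI; rewrite /nu' kI; have := dN k; case: ifP => _; lia.
have nuT : weights [set: 'I_n]%SET nu'.
  by apply: weights_extend nuI nuE _ => i /nu'2; lia.
pose P := \sum_(j in S) 'X_j * H j.
have suppP m : m \in msupp f -> (N <= wdeg nu' m)%N /\ (wdeg nu' m = N ->
    exists j a, [/\ j \in S, m = (a + U_(j))%MM, supported I a & wdeg nu a = d j]).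
  move=> mf; have [k kI mk] : exists2 k, k \notin I & (0 < m k)%N.
    by apply: not_supported; apply: contraL mf => mI; rewrite -mcoeff_eq0 fU.
  have mE : m = (m - U_(k) + U_(k))%MM by rewrite submK ?lep1mP -?lt0n.
  move: mf; rewrite mE; set a := (m - _)%MM => mf.
  have n'k := nu'2 k kI; rewrite wdegD wdegU.
  have [aI|/not_supported[l lI al]] := boolP (supported I a); last first.
    by have := wdeg_ge nu' al; have := nu'2 l lI; lia.
  have ak : a k = 0%N by apply: (supported0 aI).
  have ah : a \in msupp (h k) by rewrite mcoeff_msupp hE aI ak mulr1n -mcoeff_msupp.
  have da := (proj1 (dP k)) a ah; rewrite -(wdeg_supported aI nuE).
  have dk := dN k; rewrite /nu' (negbTE kI) in n'k *; case: ifP n'k => kS n'k.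
    split; first by lia.
    by move=> aN; exists k, a; split=> //; lia.
  by split; lia.
have PE m : P@_m = if wdeg nu' m == N then f@_m else 0.
  have termE j : j \in S -> (0 < m j)%N -> (H j)@_(m - U_(j)) =
      if (wdeg nu' m == N) && supported I (m - U_(j)) then f@_m else 0.
    move=> jS mj; have jI := TI _ (ST _ jS); rewrite HE hE.
    have mE : m = (m - U_(j) + U_(j))%MM by rewrite submK ?lep1mP -?lt0n.
    have [aI|aI] := boolP (supported I (m - U_(j))); last by rewrite andbF if_same.
    rewrite andbT -mE (supported0 aI) // mulr1n.
    have -> : wdeg nu' m = (wdeg nu (m - U_(j)) + (N - d j))%N.
      by rewrite {1}mE wdegD wdegU -(wdeg_supported aI nuE) /nu' (negbTE jI) jS.
    by congr (if _ then _ else _); have := dN j; lia.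
  rewrite /P raddf_sum /=; have [f0|mf] := eqVneq (f@_m) 0.
    rewrite f0 if_same big1 // => j jS; rewrite mcoeffXM; case: ifP => // mj.
    by rewrite termE // f0 if_same.
  have [wN|wN] := eqVneq (wdeg nu' m) N; last first.
    by rewrite big1 // => j jS; rewrite mcoeffXM; case: ifP => // mj; rewrite termE // (negbTE wN).
  rewrite -mcoeff_msupp in mf; have [_ /(_ wN)[j [a [jS mE aI _]]]] := suppP m mf.
  have aE : (m - U_(j))%MM = a by rewrite mE addmK.
  have mj : (0 < m j)%N by rewrite mE mnmDE mnm1E eqxx addn1.
  rewrite (bigD1 j) //= mcoeffXM mj termE // wN eqxx aE aI big1 ?addr0 // => l /andP[lS lj].
  rewrite mcoeffXM mE mnmDE mnm1E eq_sym (negbTE lj) (supported0 aI) //.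
  exact: TI (ST _ lS).
have InE : weight_initial nu' f = P.
  rewrite (@initial_part K n nu' f N) => [|m /suppP[]//|].
    by apply/mpolyP => m; rewrite mcoeff_part PE.
  have h0 : h j0 != 0 by move: j0T; rewrite inE.
  have [m mh md] := proj2 (dP j0) h0.
  have mI : supported I m by move: mh; rewrite supp_restrict => /andP[].
  have j0I := TI _ j0T; exists (m + U_(j0))%MM.
    by apply: supp_deriv; move: mh; rewrite supp_restrict => /andP[].
  rewrite wdegD wdegU -(wdeg_supported mI nuE) md /nu' (negbTE j0I) j0S.
  by have := dN j0; lia.
pose z i := if i \in I then x i else if i \in S then lam i else 1.
have xz : {in I, x =1 z} by move=> i iI; rewrite /z iI.
suff : (zero_locus (jacobian_ideal (weight_initial nu' f)) `&` torus [set: 'I_n]%SET)%classic z.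
  by rewrite (ndf nu').
split; last first.
  move=> i; rewrite finset.in_setT /z; have := xT i; rewrite finset.in_setT.
  case: ifP => // _ _; case: ifP; last by rewrite oner_neq0.
  by rewrite inE => /andP[].
apply: jacobian_zero => k; rewrite InE /P (raddf_sum (mderiv k)) (raddf_sum (meval z)) /=.
rewrite (eq_bigr (fun j => lam j * ((H j)^`M(k)).@[x])).
  rewrite -[RHS](lamP k) [RHS](bigID (fun j => lam j != 0)) /= [X in _ = _ + X]big1 ?addr0 //.
    by apply: eq_bigl => j; rewrite inE.
  by move=> j /andP[_ /negPn/eqP->]; rewrite mul0r.
move=> j jS; rewrite mderivM mevalD !mevalM mevalXU.
rewrite -(meval_supported (Hsupp j) xz) Hx mulr0 add0r.
rewrite {1}/z (negbTE (TI _ (ST _ jS))) jS; congr (_ * _); apply/esym.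
apply: meval_supported xz => m /supp_deriv/Hsupp; rewrite supportedD.
by case/andP.
Qed.

End Vanishing.

(** * Newton polyhedra and their faces *)

Section Geometry.
Variables (R : realType) (n : nat).
Local Open Scope classical_set_scope.

Lemma convexP (A : set 'rV[R]_n) : convex_set A <->
  forall x y (t : R), A x -> A y -> 0 <= t -> t <= 1 -> A (t *: x + (1 - t) *: y).
Proof.
split=> [cA x y t Ax Ay t0 t1|H x y k].
  by have := cA x y (Itv01 t0 t1); rewrite !inE; apply.
by rewrite !inE => Ax Ay; apply: H => //; apply: ge0.
Qed.

Lemma continuous_dotr (l : 'rV[R]_n) : continuous (dotr l).
Proof.
rewrite (_ : dotr l = fun x => \sum_i (l 0 i * x 0 i)) //.
elim: (index_enum _) => [|i s IHs].
  by under eq_fun do rewrite big_nil; apply: cst_continuous.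
under eq_fun do rewrite big_cons.
have ci : continuous (fun x : 'rV[R]_n => l 0 i * x 0 i).
  move=> x; apply: (cvgMl_tmp (FF := nbhs_filter (x : 'rV[R]_n))).
  exact: (@coord_continuous R 1 n 0 i x).
move=> x; exact: (cvgD (ci x) (IHs x)).
Qed.

Lemma dotrDr (l x y : 'rV[R]_n) : dotr l (x + y) = dotr l x + dotr l y.
Proof. by rewrite -big_split; apply: eq_bigr => i _; rewrite mxE mulrDr. Qed.

Lemma dotrZr (l x : 'rV[R]_n) t : dotr l (t *: x) = t * dotr l x.
Proof. by rewrite mulr_sumr; apply: eq_bigr => i _; rewrite mxE mulrCA. Qed.

(** Joining one point at a time exhibits the hull of a finite set as a continuous image
of a compact set. *)
Fixpoint hull (s : seq 'rV[R]_n) : set 'rV[R]_n :=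
  if s is a :: s' then
    if s' is [::] then [set a]
    else (fun z : R^o * 'rV[R]_n => z.1 *: a + (1 - z.1) *: z.2) @` (`[0, 1] `*` hull s')
  else set0.

Lemma hull_compact s : compact (hull s).
Proof.
elim: s => [|a [|b s] IHs]; [exact: compact0|exact: compact_set1|].
apply: continuous_compact; last by apply: compact_setX => //; exact: segment_compact.
apply: continuous_subspaceT => z.
have c1 : {for z, continuous (fun z : R^o * 'rV[R]_n => z.1 : R^o)} by apply: cvg_fst.
have c2 : {for z, continuous (fun z : R^o * 'rV[R]_n => z.2)} by apply: cvg_snd.
have c3 : {for z, continuous (fun z : R^o * 'rV[R]_n => 1 - z.1 : R^o)}.
  by apply: continuousB c1; apply: cvg_cst.
exact: (continuousD (continuousZr_tmp (a := a) c1) (continuousZ c3 c2)).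
Qed.

Lemma hull_convex s : convex_set (hull s).
Proof.
elim: s => [|a [|b s] IHs]; apply/convexP; first by [].
  by move=> x y t -> -> _ _; rewrite -scalerDl addrC subrK scale1r.
move=> _ _ t [[u x] /= [+ xs] <-] [[v y] /= [+ ys] <-] t0 t1.
rewrite !in_itv /= => /andP[u0 u1] /andP[v0 v1].
set T := t * u + (1 - t) * v.
have T1 : 1 - T = t * (1 - u) + (1 - t) * (1 - v) by rewrite /T; ring.
have T0 : 0 <= T by rewrite addr_ge0 // mulr_ge0 // subr_ge0.
have p0 : 0 <= t * (1 - u) by rewrite mulr_ge0 // subr_ge0.
have q0 : 0 <= (1 - t) * (1 - v) by rewrite mulr_ge0 // subr_ge0.
have Tle : T <= 1 by rewrite -subr_ge0 T1 addr_ge0.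
have [Tn|Tn] := eqVneq (1 - T) 0.
  exists (T, x) => /=; first by split=> //; rewrite in_itv /= T0.
  have pz : t * (1 - u) = 0 by apply/eqP; rewrite eq_le p0 andbT; lra.
  have qz : (1 - t) * (1 - v) = 0 by apply/eqP; rewrite eq_le q0 andbT; lra.
  rewrite Tn scale0r addr0 !scalerDr !scalerA pz qz !scale0r !addr0 -scalerDl.
  by [].
pose z := (t * (1 - u) / (1 - T)) *: x + (1 - t * (1 - u) / (1 - T)) *: y.
have Tp : 0 < 1 - T by rewrite lt_neqAle eq_sym Tn subr_ge0.
exists (T, z) => /=.
  split; first by rewrite in_itv /= T0.
  have /convexP := IHs; apply=> //; first by rewrite divr_ge0 // ltW.
  by rewrite ler_pdivrMr // mul1r T1 lerDl.
rewrite /z !scalerDr !scalerA.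
have -> : (1 - T) * (t * (1 - u) / (1 - T)) = t * (1 - u) by field.
have -> : (1 - T) * (1 - t * (1 - u) / (1 - T)) = (1 - t) * (1 - v).
  by rewrite mulrBr mulr1 mulrCA divff // mulr1 T1; ring.
by rewrite /T scalerDl !addrA; congr (_ + _); rewrite addrAC.
Qed.

Lemma hull_sub s x : x \in s -> hull s x.
Proof.
elim: s x => // a [|b s] IHs x; first by rewrite inE => /eqP->.
rewrite in_cons => /predU1P[->|/IHs sx].
  have sb : hull (b :: s) b by apply: IHs; rewrite mem_head.
  exists (1, b) => /=; last by rewrite scale1r subrr scale0r addr0.
  by split=> //; rewrite in_itv /= ler01 lexx.
exists (0, x) => /=; last by rewrite scale0r add0r subr0 scale1r.
by split=> //; rewrite in_itv /= ler01 lexx.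
Qed.

Lemma hull_min s (A : set 'rV[R]_n) : convex_set A -> (forall x, x \in s -> A x) ->
  hull s `<=` A.
Proof.
move=> /convexP cA; elim: s => [|a [|b s] IHs] sA; first by [].
  by move=> _ ->; apply: sA; rewrite inE.
move=> _ [[t x] /= [+ xs] <-]; rewrite in_itv /= => /andP[t0 t1].
apply: cA => //; first by apply: sA; rewrite mem_head.
by apply: IHs => // y ys; apply: sA; rewrite in_cons ys orbT.
Qed.

Section Newton.
Variables (K : fieldType) (g : {mpoly K[n]}).

Lemma polytope_hull : newton_polytope R g = hull [seq mpoint R m | m <- msupp g].
Proof.
apply/seteqP; split.
  apply: smallest_sub; first exact: hull_convex.
  by move=> _ [m mg <-]; apply: hull_sub; apply: map_f.
move=> x sx A [cA gA]; apply: hull_min sx => // _ /mapP[m mg ->].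
by apply: gA; exists m.
Qed.

Lemma polytope_mpoint m : m \in msupp g -> newton_polytope R g (mpoint R m).
Proof. by move=> mg; rewrite polytope_hull; apply: hull_sub; apply: map_f. Qed.

Lemma polyhedron_mpoint m : m \in msupp g -> newton_polyhedron R g (mpoint R m).
Proof.
move=> mg; exists 0; first by move=> i; rewrite mxE.
by exists (mpoint R m); rewrite ?add0r //; apply: polytope_mpoint.
Qed.

Lemma polytope_ge (l : 'rV[R]_n) c :
  (forall m, m \in msupp g -> c <= dotr l (mpoint R m)) ->
  forall z, newton_polytope R g z -> c <= dotr l z.
Proof.
move=> lc; apply: smallest_sub => [|_ [m mg <-]]; last exact: lc.
apply/convexP => x y t /= cx cy t0 t1; rewrite dotrDr !dotrZr.
have -> : c = t * c + (1 - t) * c by ring.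
by apply: lerD; rewrite ler_wpM2l // subr_ge0.
Qed.

Lemma polyhedron_ge (l : 'rV[R]_n) c : (forall i, 0 <= l 0 i) ->
  (forall m, m \in msupp g -> c <= dotr l (mpoint R m)) ->
  forall z, newton_polyhedron R g z -> c <= dotr l z.
Proof.
move=> l0 lc _ [o o0 [q qg <-]]; rewrite dotrDr.
apply: le_trans (polytope_ge lc qg) _; rewrite lerDr; apply: sumr_ge0 => i _.
by apply: mulr_ge0.
Qed.

Lemma diagram_sub : newton_diagram R g `<=` newton_polyhedron R g.
Proof. by move=> x [F [[l [c [_ ->]]] _] [gx _]]. Qed.

Definition weight_row (mu : 'I_n -> nat) : 'rV[R]_n := \row_i (mu i)%:R.

Lemma dotr_weight_mpoint mu m : dotr (weight_row mu) (mpoint R m) = (wdeg mu m)%:R.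
Proof. by rewrite /wdeg natr_sum; apply: eq_bigr => i _; rewrite !mxE natrM. Qed.

Lemma dotr_weightE mu x : dotr (weight_row mu) x = wdot mu x.
Proof. by apply: eq_bigr => i _; rewrite mxE. Qed.

(** Positive weights push the minimum onto the polytope: the orthant summand of a point
of the face has weight 0, hence is 0. *)
Lemma weight_face_compact mu c : (forall i, 0 < mu i)%N ->
  (forall m, m \in msupp g -> c <= dotr (weight_row mu) (mpoint R m)) ->
  compact (newton_polyhedron R g `&` [set x | dotr (weight_row mu) x = c]).
Proof.
move=> mu0 muc; set l := weight_row mu.
have -> : newton_polyhedron R g `&` [set x | dotr l x = c] =
    hull [seq mpoint R m | m <- msupp g] `&` (dotr l @^-1` [set c]).
  rewrite -polytope_hull; apply/seteqP; split=> [_ [[o o0 [q qg <-]] /= oq]|x [gx /= xc]].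
    have qc := polytope_ge muc qg.
    have oi i : 0 <= l 0 i * o 0 i by apply: mulr_ge0; rewrite ?mxE ?o0.
    have o_eq0 : dotr l o = 0.
      apply/eqP; rewrite eq_le sumr_ge0 // andbT.
      by move: oq qc; rewrite dotrDr -/l; lra.
    have -> : o = 0.
      apply/rowP => i; rewrite mxE; apply/eqP.
      have := o_eq0; rewrite /dotr => /eqP; rewrite psumr_eq0 // => /allP/(_ i).
      by rewrite mem_index_enum => /(_ isT); rewrite mulf_eq0 mxE pnatr_eq0 gtn_eqF.
    by rewrite add0r; split=> //=; move: oq; rewrite dotrDr o_eq0 add0r.
  split=> //; exists 0; first by move=> i; rewrite mxE.
  by exists x; rewrite ?add0r.
apply: (subclosed_compact _ (@hull_compact [seq mpoint R m | m <- msupp g])); last first.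
  by move=> x [].
apply: closedI.
  apply: compact_closed; first exact: (@norm_hausdorff R 'rV[R]_n).
  exact: hull_compact.
apply: closed_comp; first by move=> x _; apply: continuous_dotr.
exact: closed_eq.
Qed.

(** Otherwise all points of the support satisfy sum_(k != i) x_k >= 1, and so does the
whole polyhedron. *)
Lemma C_polytope_axis : C_polytope K (newton_diagram R g) -> forall i,
  exists2 m, m \in msupp g & supported [set i]%SET m.
Proof.
move=> [_ Pax] i; have [x [Px xi x0]] := Pax i.
apply: contrapT => none.
pose l : 'rV[R]_n := \row_k (k != i)%:R.
have : 1 <= dotr l x.
  apply: polyhedron_ge (diagram_sub Px) => [k|m mg]; first by rewrite mxE ler0n.
  have /not_supported[k ki mk] : ~~ supported [set i]%SET m.
    by apply/negP => mi; apply: none; exists m.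
  rewrite /dotr (bigD1 k) //= !mxE; rewrite finset.in_set1 in ki; rewrite ki mul1r.
  apply: (@le_trans _ _ ((m k)%:R)); first by rewrite (ler_nat R 1).
  by rewrite lerDl sumr_ge0 // => j _; rewrite !mxE mulr_ge0 ?ler0n.
rewrite /dotr big1 ?ler10 // => k _; rewrite mxE.
have [->|ki] := eqVneq k i; first by rewrite mul0r.
by rewrite xi ?mulr0 // finset.in_set1.
Qed.

(** If 0 is in the support then the polyhedron is the orthant, whose faces are cones; a
face containing a nonzero point is then unbounded. *)
Lemma C_polytope_const : (0 < n)%N -> C_polytope K (newton_diagram R g) ->
  0%MM \notin msupp g.
Proof.
move=> n0 [_ Pax]; apply/negP => g0; have [x [Px xi x0]] := Pax (Ordinal n0).
have [F [[l [c [lc FE]]] cF] Fx] := Px.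
have orth o : orthant o -> newton_polyhedron R g o.
  move=> o0; exists o => //; exists (mpoint R 0%MM); first exact: polytope_mpoint.
  by apply/rowP => i; rewrite !mxE mnm0E addr0.
have xo : orthant x.
  move=> i; have [->|ij] := eqVneq i (Ordinal n0); first exact: ltW.
  by rewrite xi ?lexx // finset.in_set1.
have scal t : 0 <= t -> orthant (t *: x) by move=> t0 i; rewrite mxE mulr_ge0.
have lx : dotr l x = c by move: Fx; rewrite FE => -[].
have c0 : c = 0.
  have := lc _ (orth _ (scal 0 (lexx _))); have := lc _ (orth _ (scal 2 (ler0n _ _))).
  by rewrite !dotrZr lx mul0r => c2 c0; apply/eqP; rewrite eq_le c0; lra.
have Ft t : 0 <= t -> F (t *: x).
  move=> t0; rewrite FE; split; first exact/orth/scal.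
  by rewrite /= dotrZr lx c0 mulr0.
have [M [_ MF]] := compact_bounded cF.
have x_neq0 : 0 < `|x|.
  by rewrite normr_gt0; apply/eqP => xE; move: x0; rewrite xE mxE ltxx.
have M1 : M < `|M| + 1 by apply: le_lt_trans (ler_norm M) _; rewrite ltrDl.
have H : F ((`|M| + 2) / `|x| *: x) by apply: Ft; rewrite divr_ge0 // addr_ge0.
have := MF (`|M| + 1) M1 _ H; rewrite /= normrZ ger0_norm ?divr_ge0 ?addr_ge0 //.
by rewrite divfK ?gt_eqF // lerD2l leNgt ltr1n.
Qed.

End Newton.
End Geometry.

(** * Points not below a diagram and the lowering of weights *)

Section Below.
Variables (R : realType) (K : fieldType) (n : nat) (g : {mpoly K[n]}).
Hypothesis n0 : (0 < n)%N.

Lemma not_below_weight (m : 'X_{1..n}) (mu : 'I_n -> nat) :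
  ~ lies_below (newton_diagram R g) (mpoint R m) -> (forall i, 0 < mu i)%N ->
  exists2 m', m' \in msupp g & (wdeg mu m' <= wdeg mu m)%N.
Proof.
move=> nb mu0; apply: contrapT => none; apply: nb.
have T0 : [set: 'I_n]%SET != finset.set0.
  by apply/set0Pn; exists (Ordinal n0); rewrite finset.in_setT.
have [i|q [nu [q0 nuT nuE]]] := @primitive_weights n _ mu T0.
  by rewrite mu0 finset.in_setT.
exists nu; split=> //; rewrite -dotr_weightE dotr_weight_mpoint.
apply: (@lt_le_trans _ _ ((wdeg nu m).+1%:R%:E)); first by rewrite lte_fin ltr_nat.
apply: le_ereal_inf_tmp => _ [x Px <-]; rewrite lee_fin -dotr_weightE.
apply: polyhedron_ge (diagram_sub Px) => [i|m' m'g]; first by rewrite mxE ler0n.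
rewrite dotr_weight_mpoint ler_nat ltnNge -(leq_pmul2l q0) -!(wdeg_scale _ nuE).
by apply/negP => le; apply: none; exists m'.
Qed.

(** The separation theorem for the polyhedron, with positive integer weights: Motzkin's
theorem applied to the differences with m and to the unit vectors. *)
Lemma not_below_polyhedron (m : 'X_{1..n}) : g != 0 ->
  ~ lies_below (newton_diagram R g) (mpoint R m) -> newton_polyhedron R g (mpoint R m).
Proof.
move=> gn0 nb; pose toQ (a : 'X_{1..n}) : 'rV[rat]_n := \row_i (a i)%:R.
have [m1 m1g] : exists m1, m1 \in msupp g.
  by move: gn0; rewrite -msupp_eq0; case: (msupp g) => // m1 s _; exists m1; rewrite mem_head.
pose us := [seq toQ a - toQ m | a <- msupp g] ++ [seq delta_mx 0 i | i <- enum 'I_n].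
pose toR : 'rV[rat]_n -> 'rV[R]_n := map_mx ratr.
(* the nontrivial combinations that form the cone over the polyhedron translated by
   - m *)
pose C z := exists s o q, [/\ 0 <= s, orthant o, newton_polytope R g q,
  toR z = s *: (q - mpoint R m) + o & (0 < s) \/ o != 0].
have toRD x y : toR (x + y) = toR x + toR y by apply/rowP => i; rewrite !mxE rmorphD.
have toRZ a x : toR (a *: x) = ratr a *: toR x by apply/rowP => i; rewrite !mxE rmorphM.
have toRm a : toR (toQ a) = mpoint R a by apply/rowP => i; rewrite !mxE ratr_nat.
have sub_pos (s s' : R) (o o' : 'rV[R]_n) : 0 <= s -> 0 <= s' -> orthant o -> orthant o' ->
    (0 < s) \/ o != 0 -> (0 < s + s') \/ o + o' != 0.
  move=> s0 s'0 o0 o'0 [sp|/rV0Pn[i oi]]; first by left; rewrite ltr_wpDr.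
  right; apply/rV0Pn; exists i; rewrite mxE gt_eqF // ltr_wpDr ?o'0 //.
  by rewrite lt_neqAle eq_sym oi o0.
have [||u|[w [_ wus]]|[z [[s [o [q [s0 o0 qg zE spos]]]] z0]]] :=
  @motzkin n us C 0 (0 : 'M_(0, n)).
- move=> x y [s [o [q [s0 o0 qg xE xpos]]]] [s' [o' [q' [s'0 o'0 q'g yE ypos]]]].
  have oo' : orthant (o + o') by move=> i; rewrite mxE addr_ge0.
  have [ss|ss] := eqVneq (s + s') 0.
    have sz : s = 0 by lra.
    have s'z : s' = 0 by lra.
    exists 0, (o + o'), q; split=> //.
      by rewrite toRD xE yE sz s'z !scale0r !add0r.
    by have := sub_pos s s' o o' s0 s'0 o0 o'0 xpos; rewrite ss.
  have sp : 0 < s + s' by rewrite lt_neqAle eq_sym ss addr_ge0.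
  pose t := s / (s + s').
  exists (s + s'), (o + o'), (t *: q + (1 - t) *: q'); split=> //.
  + by rewrite addr_ge0.
  + have qc : convex_set (newton_polytope R g) by rewrite polytope_hull; apply: hull_convex.
    apply: (proj1 (convexP _) qc) => //; first by rewrite divr_ge0 // ltW.
    by rewrite ler_pdivrMr // mul1r lerDl.
  + rewrite toRD xE yE addrACA; congr (_ + _).
    have sE : s = (s + s') * t by rewrite mulrC divfK.
    have s'E : s' = (s + s') * (1 - t) by rewrite mulrBr mulr1 -sE addrC addKr.
    apply/rowP => i; rewrite !mxE {1}sE {2}s'E; ring.
  + exact: sub_pos.
- move=> a x a0 [s [o [q [s0 o0 qg xE xpos]]]].
  have ra : 0 < ratr a :> R by rewrite ltr0q.
  exists (ratr a * s), (ratr a *: o), q; split=> //.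
  + by rewrite mulr_ge0 // ltW.
  + by move=> i; rewrite mxE mulr_ge0 // ltW.
  + by rewrite toRZ xE scalerDr scalerA.
  + case: xpos => [sp|on]; first by left; rewrite mulr_gt0.
    by right; rewrite scaler_eq0 negb_or gt_eqF.
- rewrite mem_cat => /orP[/mapP[a ag ->]|/mapP[i _ ->]].
  + exists 1, 0, (mpoint R a); split=> //.
    * by move=> i; rewrite mxE.
    * exact: polytope_mpoint.
    * rewrite addr0 scale1r -!toRm -[- toR _]scaleN1r.
      have -> : -1 = ratr (-1) :> R by rewrite rmorphN1.
      by rewrite -toRZ -toRD scaleN1r.
    * by left.
  + exists 0, (delta_mx 0 i), (mpoint R m1); split=> //.
    * by move=> j; rewrite mxE ler0n.
    * exact: polytope_mpoint.
    * by rewrite scale0r add0r; apply/rowP => j; rewrite !mxE ratr_nat.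
    * by right; apply/rV0Pn; exists i; rewrite mxE !eqxx oner_eq0.
(* w is a positive weight that puts m below the diagram *)
- exfalso; have w0 i : 0 < w i 0.
    have := wus (delta_mx 0 i); rewrite -rowE mxE; apply.
    by rewrite mem_cat map_f ?orbT // mem_enum.
  have [q [mu [q0 mu0 muE]]] := pos_weights w0.
  have [m' m'g] := not_below_weight nb mu0; rewrite leqNgt => /negP; apply.
  have wdE a : (wdeg mu a)%:R = q%:R * (toQ a *m w) 0 0 :> rat.
    rewrite mxE mulr_sumr natr_sum; apply: eq_bigr => i _.
    by rewrite natrM muE mxE; ring.
  rewrite -(ltr_nat rat) !wdE ltr_pM2l ?ltr0n // -subr_gt0.
  have := wus (toQ m' - toQ m); rewrite mulmxBl.
  have -> (a b : 'M[rat]_1) : (a - b) 0 0 = a 0 0 - b 0 0 by rewrite !mxE.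
  apply.
  by rewrite mem_cat; apply/orP; left; apply/mapP; exists m'.
- have [D] := submxP z0; rewrite mulmx0 => zz; move: zE; rewrite zz.
  have -> : toR 0 = 0 by apply/rowP => i; rewrite !mxE rmorph0.
  move=> /esym/eqP; rewrite addr_eq0 => /eqP sq.
  have [sz|sn] := eqVneq s 0.
    case: spos; first by rewrite sz ltxx.
    by move: sq => /eqP; rewrite sz scale0r eq_sym oppr_eq0 => ->.
  exists (s^-1 *: o); first by move=> i; rewrite mxE mulr_ge0 ?invr_ge0.
  exists q => //; have -> : o = - (s *: (q - mpoint R m)) by rewrite sq opprK.
  by rewrite scalerN scalerA mulVf // scale1r opprB subrK.
Qed.

End Below.

Section Cover.
Variables (n : nat) (A : seq 'X_{1..n}).
Implicit Types (w : 'I_n -> rat) (m : 'X_{1..n}) (k : 'I_n).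

Definition rval w m : rat := \sum_i w i * (m i)%:R.

Hypothesis axisA : forall k, exists2 m, m \in A & (0 < m k)%N /\ forall i, i != k -> m i = 0%N.

(** The weight of k is lowered as far as the constraints allow, which makes a point with
positive k-th coordinate minimal.  It stays positive because the point of A on the
k-th axis has weight at least c.  Points that were already minimal remain so: if the
k-th coordinate of one of them is positive, the weight cannot be lowered at all. *)
Lemma cover_step w c k : (forall i, 0 < w i) -> 0 < c ->
  (forall m, m \in A -> c <= rval w m) ->
  exists w', [/\ forall i, 0 < w' i, forall i, w' i <= w i,
    forall m, m \in A -> c <= rval w' m,
    forall m, m \in A -> rval w m = c -> rval w' m = c &
    exists2 m, m \in A & rval w' m = c /\ (0 < m k)%N].
Proof.
move=> w0 c0 wc; pose B := [seq m : 'X_{1..n} <- A | (0 < m k)%N].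
(* the smallest weight of k that keeps the weight of m at least c *)
pose need (m : 'X_{1..n}) := (c - (rval w m - w k * (m k)%:R)) / (m k)%:R.
have [a aA [ak a0]] := axisA k.
have aB : a \in B by rewrite mem_filter ak.
have [||||m1 m1B m1max] := @exists_total_min _ (fun x y => is_true (need y <= need x)) B.
- by apply: contraL aB => /eqP->.
- by [].
- by move=> x y z xy yz; apply: le_trans yz xy.
- by move=> x y _ _; apply/orP; rewrite orbC le_total.
pose v := need m1; pose w' i := if i == k then v else w i.
move: m1B; rewrite mem_filter => /andP[m1k m1A].
have natk (m : 'X_{1..n}) : (0 < m k)%N -> 0 < (m k)%:R :> rat by rewrite ltr0n.
have rvalE m : rval w' m = rval w m - (w k - v) * (m k)%:R.
  rewrite /rval (bigD1 k) //= [X in _ = X - _](bigD1 k) //= /w' eqxx.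
  rewrite (eq_bigr (fun i => w i * (m i)%:R)); first by ring.
  by move=> i /negbTE->.
have needE m : (0 < m k)%N -> rval w' m = c + (v - need m) * (m k)%:R.
  move=> mk; rewrite rvalE mulrBl [_ * (m k)%:R in RHS]mulrBl /need divfK ?gt_eqF ?natk //.
  ring.
have vpos : 0 < v.
  apply: lt_le_trans (m1max a aB); apply: divr_gt0; last exact: natk.
  have -> : rval w a = w k * (a k)%:R.
    by rewrite /rval (bigD1 k) //= big1 ?addr0 // => i /a0->; rewrite mulr0.
  by rewrite subrr subr0.
have need_le m : m \in A -> (0 < m k)%N -> need m <= w k.
  by move=> mA mk; rewrite ler_pdivrMr ?natk //; have := wc m mA; lra.
exists w'; split.
- by move=> i; rewrite /w'; case: eqP.
- by move=> i; rewrite /w'; case: eqP => // ->; apply: need_le.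
- move=> m mA; have [mk|] := posnP (m k); first by rewrite rvalE mk mulr0 subr0 wc.
  move=> mk; rewrite needE // lerDl mulr_ge0 ?ler0n // subr_ge0 m1max //.
  by rewrite mem_filter mk.
- move=> m mA mc; have [mk|mk] := posnP (m k); first by rewrite rvalE mk mulr0 subr0.
  have needm : need m = w k by rewrite /need mc opprB addrC subrK mulfK // gt_eqF ?natk.
  rewrite rvalE; suff -> : v = w k by rewrite subrr mul0r subr0.
  apply/eqP; rewrite eq_le need_le //= -needm m1max //.
  by rewrite mem_filter mk.
- by exists m1 => //; rewrite needE // subrr mul0r addr0.
Qed.

(** [cover_step] for each k in turn: since minimal points remain minimal, a coordinate
that is positive somewhere on the minimal face stays so. *)
Lemma cover_all w c : (forall i, 0 < w i) -> 0 < c ->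
  (forall m, m \in A -> c <= rval w m) ->
  exists w', [/\ forall i, 0 < w' i, forall i, w' i <= w i,
    forall m, m \in A -> c <= rval w' m,
    forall m, m \in A -> rval w m = c -> rval w' m = c &
    forall k, exists2 m, m \in A & rval w' m = c /\ (0 < m k)%N].
Proof.
move=> w0 c0 wc.
suff [w' [w'0 w'w w'c w'eq w'k]] : exists w', [/\ forall i, 0 < w' i, forall i, w' i <= w i,
    forall m, m \in A -> c <= rval w' m,
    forall m, m \in A -> rval w m = c -> rval w' m = c &
    forall k, k \in enum 'I_n -> exists2 m, m \in A & rval w' m = c /\ (0 < m k)%N].
  by exists w'; split=> // k; apply: w'k; rewrite mem_enum.
elim: (enum 'I_n) => [|k s [w1 [w10 w1w w1c w1eq w1k]]]; first by exists w; split.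
have [w2 [w20 w2w w2c w2eq w2k]] := cover_step k w10 c0 w1c.
exists w2; split=> // [i|m mA mc|l].
- exact: le_trans (w2w i) (w1w i).
- by apply: w2eq => //; apply: w1eq.
- rewrite in_cons => /predU1P[->//|/w1k[m mA [mc ml]]].
  by exists m => //; split=> //; apply: w2eq.
Qed.

End Cover.

(** * The three cases *)

Section InnerFaces.
Variables (R : realType) (K : fieldType) (n : nat).
Implicit Types (f g : {mpoly K[n]}) (nu : 'I_n -> nat) (m : 'X_{1..n}).

Lemma weight_initial_scale nu mu q g : (0 < q)%N -> (forall i, mu i = q * nu i)%N ->
  weight_initial mu g = weight_initial nu g.
Proof.
move=> q0 muE; rewrite /weight_initial; apply: eq_bigl => m.
by apply: eq_all => m'; rewrite !(wdeg_scale _ muE) leq_pmul2l.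
Qed.

(** Starting from nu on I and large weights off I, the weights are lowered by [cover_all]
and multiplied by a common denominator q.  The monomial m0 of g in R^I
of least nu-weight is minimal for the old and the new weights. *)
Lemma inner_face_weights g (I : {set 'I_n}) nu : (0 < n)%N ->
  C_polytope K (newton_diagram R g) -> I != finset.set0 -> weights I nu ->
  exists (q C : nat) (mu : 'I_n -> nat) m0, [/\ (0 < q)%N, forall i, (0 < mu i)%N &
    [/\ forall i, i \in I -> (mu i <= q * nu i)%N,
      forall m, m \in msupp g -> (C <= wdeg mu m)%N,
      forall k, exists2 m, m \in msupp g & wdeg mu m = C /\ (0 < m k)%N &
      [/\ m0 \in msupp g, m0 != 0%MM, supported I m0, wdeg mu m0 = C & C = q * wdeg nu m0]%N]].
Proof.
move=> n0 Cg I0 nuI.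
have g0 := C_polytope_const n0 Cg.
have axis k : exists2 m, m \in msupp g & (0 < m k)%N /\ forall i, i != k -> m i = 0%N.
  have [m mg mk] := C_polytope_axis Cg k; exists m => //.
  have mi i : i != k -> m i = 0%N by move=> ik; apply: (supported0 mk); rewrite finset.in_set1.
  split=> //; rewrite lt0n; apply: contraNneq g0 => mk0.
  suff <- : m = 0%MM by [].
  by apply/mnmP => i; rewrite mnm0E; have [->|/mi] := eqVneq i k.
have [i0 i0I] : exists i, i \in I by apply/set0Pn.
have Ig : [seq m <- msupp g | supported I m] != [::].
  have [m mg [mk mi]] := axis i0.
  suff : m \in [seq m <- msupp g | supported I m] by case: [seq _ <- _ | _].
  rewrite mem_filter mg andbT; apply/supportedP => k kI; apply: mi.
  by apply: contraNneq kI => ->.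
have [m0 m0I m0min] := exists_nat_min (wdeg nu) Ig.
move: m0I; rewrite mem_filter => /andP[m0I m0g].
set c := wdeg nu m0 in m0min.
have m0n0 : m0 != 0%MM by apply: contraNneq g0 => <-.
have c0 : (0 < c)%N.
  have [k mk] : exists k, (0 < m0 k)%N.
    apply: contrapT => none; case/eqP: m0n0; apply/mnmP => i; rewrite mnm0E.
    by apply/eqP; rewrite -leqn0 leqNgt; apply/negP => mi; apply: none; exists i.
  have kI : k \in I by apply: contraTT mk => kI; rewrite (supported0 m0I kI).
  by apply: leq_trans (wdeg_ge nu mk); case: nuI => ->.
pose w0 i : rat := (if i \in I then nu i else c)%:R.
have w0E m : supported I m -> rval w0 m = (wdeg nu m)%:R.
  move=> mI; rewrite natr_sum; apply: eq_bigr => i _; rewrite /w0 natrM.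
  by case: ifP => // /negbT iI; rewrite (supported0 mI iI) !mulr0.
have w00 i : 0 < w0 i by rewrite ltr0n; case: ifP => // iI; case: nuI => ->.
have w0c m : m \in msupp g -> c%:R <= rval w0 m.
  move=> mg; have [mI|/not_supported[k kI mk]] := boolP (supported I m).
    by rewrite w0E // ler_nat m0min // mem_filter mI.
  rewrite /rval (bigD1 k) //= {1}/w0 (negbTE kI).
  apply: (@le_trans _ _ (c%:R * (m k)%:R)); first by rewrite -natrM ler_nat leq_pmulr.
  by rewrite lerDl sumr_ge0 // => i _; rewrite mulr_ge0 ?ler0n // ltW.
have c0' : 0 < c%:R :> rat by rewrite ltr0n.
have [w [wpos ww0 wc weq wk]] := cover_all axis w00 c0' w0c.
have [q [mu [q0 mu0 muE]]] := pos_weights wpos.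
have wdE m : (wdeg mu m)%:R = q%:R * rval w m :> rat.
  by rewrite natr_sum mulr_sumr; apply: eq_bigr => i _; rewrite natrM muE mulrA.
exists q, (q * c)%N, mu, m0; split=> //; split.
- move=> i iI; rewrite -(ler_nat rat) muE natrM ler_wpM2l ?ler0n //.
  by apply: le_trans (ww0 i) _; rewrite /w0 iI.
- by move=> m mg; rewrite -(ler_nat rat) wdE natrM ler_wpM2l ?ler0n // wc.
- move=> k; have [m mg [mc mk]] := wk k; exists m => //; split=> //.
  by apply/eqP; rewrite -(eqr_nat rat) wdE mc natrM.
- split=> //; apply/eqP; rewrite -(eqr_nat rat) wdE (weq m0) ?natrM //.
  by rewrite w0E.
Qed.

(** A point of the face with positive k-th coordinate, for each k, keeps it out of every
proper coordinate subspace. *)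
Lemma weight_face_inner g mu C : (forall i, 0 < mu i)%N ->
  (forall m, m \in msupp g -> C <= wdeg mu m)%N ->
  (forall k, exists2 m, m \in msupp g & wdeg mu m = C /\ (0 < m k)%N) ->
  inner_face K (newton_diagram R g)
    (newton_polyhedron R g `&` [set x | dotr (weight_row R mu) x = C%:R])%classic.
Proof.
move=> mu0 muC cov; set D := (_ `&` _)%classic.
have muC' m : m \in msupp g -> C%:R <= dotr (weight_row R mu) (mpoint R m).
  by move=> mg; rewrite dotr_weight_mpoint ler_nat muC.
split=> [|J JT DJ].
  exists g; split=> //; last exact: weight_face_compact.
  exists (weight_row R mu), C%:R; split=> // x.
  by apply: polyhedron_ge => // i; rewrite mxE ler0n.
have [k kJ] : exists k, k \notin J.
  apply: contrapT => none; case/eqP: JT; apply/setP => k; rewrite finset.in_setT.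
  by apply: contrapT => /negP kJ; apply: none; exists k.
have [m mg [mC mk]] := cov k.
have /DJ/(_ k kJ)/eqP : D (mpoint R m).
  by split; [apply: polyhedron_mpoint|rewrite /= dotr_weight_mpoint mC].
by rewrite mxE pnatr_eq0 gtn_eqF.
Qed.

(** Let mu be the lowered weights of [inner_face_weights], D the inner face of the points
of minimal mu-weight and I' the subset of I where mu agrees with q nu.  A monomial
of the restricted derivative of f of weight C - mu j for q nu has the same weight for
mu and is supported on I', so the derivatives of the face polynomial on K^I' are
parts of the restricted derivatives of f: zero or initial.  Replacing by 0 the coordinates of
x outside I' therefore gives a forbidden zero. *)
Lemma inner_nondegenerate_restrict f (I : {set 'I_n}) nu (x : 'I_n -> K) : (0 < n)%N ->
  inner_newton_nondegenerate R f -> I != finset.set0 -> weights I nu ->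
  torus [set: 'I_n]%SET x ->
  (forall j, (weight_initial nu (restrict_coord I f^`M(j))).@[x] = 0) -> False.
Proof.
move=> n0 [P CP [nbelow inner]] I0 nuI xT x0.
have [g PE] := proj1 CP; rewrite {P}PE in CP nbelow inner.
have [q [C [mu [m0 [q0 mu0 [mu_le muC cov [m0g m0n0 m0I m0C CE]]]]]]] :=
  inner_face_weights n0 CP I0 nuI.
have gn0 : g != 0 by apply: contraTneq m0g => ->; rewrite msupp0.
pose D := (newton_polyhedron R g `&` [set x | dotr (weight_row R mu) x = C%:R])%classic.
have inD : inner_face K (newton_diagram R g) D by apply: weight_face_inner.
have fC m : m \in msupp f -> (C <= wdeg mu m)%N.
  move=> /nbelow nb; have [m' m'g] := not_below_weight n0 nb mu0.
  exact: leq_trans (muC _ m'g).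
have mu_wdeg m : supported I m -> (wdeg mu m <= q * wdeg nu m)%N.
  move=> mI; rewrite /wdeg big_distrr; apply: leq_sum => i _ /=.
  have [iI|iI] := boolP (i \in I); first by rewrite mulnA leq_mul2r mu_le ?orbT.
  by rewrite (supported0 mI iI) !muln0.
pose I' := [set i in I | mu i == q * nu i]%SET%N.
(* where the two weights agree on a monomial, they agree on its variables *)
have tight m : supported I m -> wdeg mu m = (q * wdeg nu m)%N -> supported I' m.
  move=> mI mE; apply/supportedP => k; rewrite inE negb_and => /orP[kI|kmu].
    exact: supported0 mI kI.
  have [kI|kI] := boolP (k \in I); last exact: supported0 mI kI.
  have [//|mk] := posnP (m k); have lt_k : (mu k * m k < q * (nu k * m k))%N.
    by rewrite mulnA ltn_pmul2r // ltn_neqAle kmu mu_le.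
  have : (wdeg mu m < q * wdeg nu m)%N.
    rewrite /wdeg big_distrr (bigD1 k) //= [X in (_ < X)%N](bigD1 k) //= -addSn.
    apply: leq_add => //; apply: leq_sum => i _.
    have [iI|iI] := boolP (i \in I); first by rewrite mulnA leq_mul2r mu_le ?orbT.
    by rewrite (supported0 mI iI) !muln0.
  by rewrite mE ltnn.
have tightE m : supported I' m -> supported I m /\ wdeg mu m = (q * wdeg nu m)%N.
  move=> mI'; split.
    apply/supportedP => k kI; apply: (supported0 mI'); rewrite inE (negbTE kI) //.
  rewrite /wdeg big_distrr; apply: eq_bigr => i _ /=.
  have [|iI] := boolP (i \in I'); last by rewrite (supported0 mI' iI) !muln0.
  by rewrite inE => /andP[_ /eqP->]; rewrite mulnA.
have m0I' : supported I' m0 by apply: tight; rewrite // m0C.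
have I'0 : I' != finset.set0.
  apply: contraNneq m0n0 => I'E; apply/eqP/mnmP => i; rewrite mnm0E.
  by apply: (supported0 m0I'); rewrite I'E finset.in_set0.
have DI' : (D `&` coord_subspace I' !=set0)%classic.
  exists (mpoint R m0); split; last by move=> i iI'; rewrite mxE (supported0 m0I' iI').
  by split; [apply: polyhedron_mpoint|rewrite /= dotr_weight_mpoint m0C].
pose x' i := if i \in I' then x i else 0.
suff : (zero_locus (jacobian_ideal (face_initial D f)) `&` torus I')%classic x'.
  by rewrite (inner D inD I' I'0 DI').
split; last first.
  move=> i; rewrite /x'; case: ifP => _; last by rewrite eqxx.
  by rewrite xT finset.in_setT.
apply: jacobian_zero => j.
have -> : face_initial D f = part (fun m => wdeg mu m == C) f.
  rewrite -[LHS]/(part _ f); apply: part_eq => m.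
  have [mf|mf] := boolP (m \in msupp f); last by rewrite (memN_msupp_eq0 mf) !if_same.
  congr (if _ then _ else _); apply/asboolP/eqP => [[_ /=]|mC].
    by rewrite dotr_weight_mpoint => /eqP; rewrite eqr_nat => /eqP.
  split; last by rewrite /= dotr_weight_mpoint mC.
  by apply: not_below_polyhedron => //; apply: nbelow.
rewrite mderiv_part -/x' -meval_restrict.
pose qnu i := (q * nu i)%N.
have qnuE m : wdeg qnu m = (q * wdeg nu m)%N by apply: wdeg_scale.
rewrite -(@initial_root K n qnu (restrict_coord I f^`M(j)) C (mu j) x) //; last first.
- by rewrite (@weight_initial_scale nu qnu q).
- move=> m; rewrite supp_restrict => /andP[mI /supp_deriv/fC].
  by rewrite wdegD wdegU qnuE => /leq_trans -> //; rewrite leq_add2r mu_wdeg.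
congr (_.@[x]); apply/mpolyP => m; rewrite !mcoeff_restrict !mcoeff_part mcoeff_restrict qnuE.
have [mI'|mI'] := boolP (supported I' m); first by have [-> ->] := tightE m mI'.
case: eqP => // mC; case: ifP => // mI; apply/esym/eqP; rewrite mcoeff_eq0.
apply: contra mI' => /supp_deriv/fC; rewrite wdegD wdegU -mC leq_add2r => le_mu.
by apply: tight => //; apply/eqP; rewrite eqn_leq le_mu mu_wdeg.
Qed.

End InnerFaces.

(** The derivatives of f are one of the systems over which [Gamma_1, ..., Gamma_n]_0 is
the minimum, and [local_dim_finite] applies to them. *)
Lemma partially_milnor_of_torus (R : realType) (K : closedFieldType) n (f : {mpoly K[n]}) :
  (forall I, I != finset.set0 -> forall nu, weights I nu ->
     ~ exists2 x, torus [set: 'I_n] x &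
         forall j, (weight_initial nu (restrict_coord I f^`M(j))).@[x] = 0) ->
  partially_milnor_nondegenerate R f.
Proof.
move=> tf; split=> //; apply: le_lt_trans (local_dim_finite R tf).
by apply: ereal_inf_lbound; exists (fun j => f^`M(j)).
Qed.

Theorem proposition5p11 (R : realType) (K : closedFieldType) (n : nat)
    (hn : (1 <= n)%N) (f : {mpoly K[n]}) :
  [/\ convenient R f /\ newton_nondegenerate f ->
        partially_milnor_nondegenerate R f,
      newton_nondegenerate f /\ (milnor_number R f < +oo)%E ->
        partially_milnor_nondegenerate R f
    & inner_newton_nondegenerate R f ->
        partially_milnor_nondegenerate R f].
Proof.
split.
- move=> [cf ndf]; apply: partially_milnor_of_torus => I I0 nu nuI [x xT x0].
  apply: (nondegenerate_restrict ndf nuI _ xT x0).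
  have [i iI] : exists i, i \in I by apply/set0Pn.
  have [m mf mi] := C_polytope_axis cf i.
  apply: contraTneq mf => fI; rewrite mcoeff_msupp negbK.
  have := congr1 (mcoeff m) fI; rewrite mcoeff_restrict mcoeff0 ifT => [->//|].
  apply/supportedP => k kI; apply: (supported0 mi).
  by rewrite finset.in_set1; apply: contraNneq kI => ->.
- move=> [ndf mu_fin]; apply: partially_milnor_of_torus => I I0 nu nuI [x xT x0].
  have [fI|fI] := eqVneq (restrict_coord I f) 0; last first.
    exact: (nondegenerate_restrict ndf nuI fI xT x0).
  apply: (nondegenerate_vanishing ndf nuI I0 fI _ xT x0).
  apply: (finite_system_count mu_fin I0) => j; apply: contrapT => /eqP h0.
  have := @initial_root K n nu (restrict_coord I f^`M(j)) 0 0 x (fun _ _ => leq0n _) (x0 j).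
  have -> : part (fun m => wdeg nu m + 0 == 0)%N (restrict_coord I f^`M(j)) =
      ((restrict_coord I f^`M(j))@_0%MM)%:MP.
    apply/mpolyP => m; rewrite mcoeff_part mcoeffC addn0.
    have [->|m0] := eqVneq m 0%MM.
      by rewrite /wdeg big1 ?eqxx ?mulr1 // => i _; rewrite mnm0E muln0.
    rewrite mulr0; case: eqP => // wm; rewrite mcoeff_restrict; case: ifP => // mI.
    case/eqP: m0; apply/mnmP => i; rewrite mnm0E; have [iI|iI] := boolP (i \in I); last first.
      exact: supported0 mI iI.
    apply/eqP; rewrite -leqn0 leqNgt; apply/negP => /(wdeg_ge nu); rewrite wm leqn0.
    by case: nuI => /(_ i) + _; rewrite iI lt0n => /negP.
  by rewrite mevalC => /eqP; rewrite (negbTE h0).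
- move=> inf; apply: partially_milnor_of_torus => I I0 nu nuI [x xT x0].
  exact: (inner_nondegenerate_restrict hn inf I0 nuI xT x0).
Qed.
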